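(* Let $\mathcal P_t=e^{t\mathcal L}$ be a primitive quantum Markov semigroup satisfying the $\sigma$-GNS detailed balance condition for its full-rank invariant state $\sigma$. If the $p'$-Beckner inequality $(\mathrm{Bec}_{p'})$ holds for some $p'\in(1,2]$ with constant $\alpha_{p'}>0$, then for every $1<p\le p'$ the inequality $(\mathrm{Bec}_p)$ holds with a constant $\alpha_p$ satisfying $$\frac{p}{p-1}\,\alpha_p\ \ge\ \frac{p'}{p'-1}\,\alpha_{p'} .$$ Equivalently, $p\mapsto \frac{p}{p-1}\alpha_p(\mathcal L)$ is nonincreasing on $(1,2]$.
   Context: $\mathcal H$ is a finite-dimensional Hilbert space, $\mathcal B(\mathcal H)$ the operators on it. A quantum Markov semigroup (QMS) is a $C_0$-semigroup $(\mathcal P_t)_{t\ge0}$ of completely positive unital maps on $\mathcal B(\mathcal H)$, with generator $\mathcal L$; $\dagger$ is the adjoint for the Hilbert–Schmidt inner product. It is primitive if it has a unique invariant state $\sigma$ ($\mathcal P_t^\dagger(\sigma)=\sigma$ for all $t$) and $\sigma$ has full rank. The $\sigma$-GNS detailed balance condition means that $\mathcal L$ is self-adjoint for $\langle X,Y\rangle_{\sigma,1}=\mathrm{Tr}(\sigma X^*Y)$. Put $\langle X,Y\rangle_{\sigma,1/2}=\mathrm{Tr}(\sigma^{1/2}X^*\sigma^{1/2}Y)$. Let $\Gamma_\sigma^{s}(X)=\sigma^{s/2}X\sigma^{s/2}$ for $s\in\mathbb R$, $\|X\|_{p,\sigma}=\mathrm{Tr}\big(|\Gamma_\sigma^{1/p}(X)|^p\big)^{1/p}$,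 and $\hat p=p/(p-1)$. For $X>0$ the $p$-Dirichlet form is $$\mathcal E_{p,\mathcal L}(X)=-\frac{\hat p\,p}{4}\Big\langle \Gamma_\sigma^{-1/\hat p}\big((\Gamma_\sigma^{1/p}(X))^{p-1}\big),\mathcal L(X)\Big\rangle_{\sigma,1/2}.$$ $(\mathrm{Bec}_p)$ with constant $\alpha_p$: $\alpha_p\,\hat p\,\big(\|X\|_{p,\sigma}^p-\|X\|_{1,\sigma}^p\big)\le\mathcal E_{p,\mathcal L}(X)$ for all $X>0$. The optimal (largest) constant is denoted $\alpha_p(\mathcal L)$. *)

(* Defs.v *)
From HB Require Import structures.
From mathcomp Require Import all_boot all_order all_algebra.
From mathcomp Require Import complex.
From mathcomp Require Import all_classical all_reals all_analysis.

Set Implicit Arguments.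
Unset Strict Implicit.
Unset Printing Implicit Defensive.

Import Order.TTheory GRing.Theory Num.Theory.
Import numFieldNormedType.Exports.

Local Open Scope classical_set_scope.
Local Open Scope ring_scope.
Local Open Scope complex_scope.
Local Open Scope sesquilinear_scope.

(* Topology of R[i] induced by the modulus; matrices get the entrywise one. *)
HB.instance Definition _ (R : realType) :=
  PseudoPointedMetric.copy R[i] (R[i]^o).

(* The n-dimensional Hilbert space is C^n with C = R[i], so that operators are
   matrices 'M[R[i]]_n. On R[i], [0 <= z] means that z is real and nonnegative. *)

Section Operators.
Variable R : realType.
Local Notation C := R[i].

Definition psdmx n (A : 'M[C]_n) : Prop :=
  A \is hermsymmx /\ forall v : 'cV[C]_n, 0 <= (v^t* *m A *m v) 0 0.

Definition pdmx n (A : 'M[C]_n) : Prop :=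
  A \is hermsymmx /\ forall v : 'cV[C]_n, v != 0 -> 0 < (v^t* *m A *m v) 0 0.

Definition state n (rho : 'M[C]_n) : Prop := psdmx rho /\ \tr rho = 1.

(* f(A) by spectral calculus. For A hermitian, spectral_diag A lists the (real)
   eigenvalues of A; the value is junk if A is not hermitian. *)
Definition mxfun (f : R -> R) n (A : 'M[C]_n) : 'M[C]_n :=
  invmx (spectralmx A)
    *m diag_mx (map_mx (fun z : C => (f (complex.Re z))%:C) (spectral_diag A))
    *m spectralmx A.

Definition mxpowR n (A : 'M[C]_n) (s : R) : 'M[C]_n := mxfun (fun x => x `^ s) A.

Definition absmx n (A : 'M[C]_n) : 'M[C]_n := mxfun Num.sqrt (A^t* *m A).

Definition hs_dot n (X Y : 'M[C]_n) : C := \tr (X^t* *m Y).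

(* Adjoint for hs_dot, given by its matrix coefficients
   hs_dot (delta_mx i j) (hs_adj Phi Y) = hs_dot (Phi (delta_mx i j)) Y. *)
Definition hs_adj n (Phi : 'M[C]_n -> 'M[C]_n) (Y : 'M[C]_n) : 'M[C]_n :=
  \matrix_(i, j) hs_dot (Phi (delta_mx i j)) Y.

Lemma hs_dotE n (X Y : 'M[C]_n) :
  hs_dot X Y = \sum_i \sum_j (X i j)^* * Y i j.
Proof.
rewrite /hs_dot /mxtrace exchange_big /=; apply: eq_bigr => i _.
by rewrite !mxE; apply: eq_bigr => j _; rewrite !mxE.
Qed.

Lemma hs_adjP n (Phi : {linear 'M[C]_n -> 'M[C]_n}) (X Y : 'M[C]_n) :
  hs_dot X (hs_adj Phi Y) = hs_dot (Phi X) Y.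
Proof.
have PhiE k l : Phi X k l = \sum_i \sum_j X i j * Phi (delta_mx i j) k l.
  rewrite {1}(matrix_sum_delta X) linear_sum summxE; apply: eq_bigr => i _.
  rewrite linear_sum summxE; apply: eq_bigr => j _.
  by rewrite linearZ !mxE.
rewrite !hs_dotE.
under [RHS]eq_bigr do under eq_bigr do
  rewrite PhiE rmorph_sum mulr_suml.
under [RHS]eq_bigr do rewrite exchange_big.
rewrite [RHS]exchange_big; apply: eq_bigr => i _ /=.
under [RHS]eq_bigr do under eq_bigr do
  rewrite rmorph_sum mulr_suml.
under [RHS]eq_bigr do rewrite exchange_big.
rewrite [RHS]exchange_big; apply: eq_bigr => j _ /=.
rewrite mxE hs_dotE mulr_sumr; apply: eq_bigr => k _.
rewrite mulr_sumr; apply: eq_bigr => l _.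
by rewrite rmorphM mulrA.
Qed.

Definition gns_dot n (sigma X Y : 'M[C]_n) : C := \tr (sigma *m X^t* *m Y).

Definition kms_dot n (sigma X Y : 'M[C]_n) : C :=
  \tr (mxpowR sigma 2^-1 *m X^t* *m mxpowR sigma 2^-1 *m Y).

(* Positivity of id_k (x) Phi for every k: an operator on C^k (x) C^n is a
   k x k block matrix of operators on C^n. *)
Definition completely_positive n (Phi : 'M[C]_n -> 'M[C]_n) : Prop :=
  forall (k : nat) (X : 'I_k -> 'I_k -> 'M[C]_n),
    psdmx (\mxblock_(i < k, j < k) X i j) ->
    psdmx (\mxblock_(i < k, j < k) Phi (X i j)).

(* Only the values of P at t >= 0 are meaningful. *)
Definition qms n (P : R -> {linear 'M[C]_n -> 'M[C]_n}) : Prop :=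
  [/\ forall X, P 0 X = X,
      forall (s t : R) X, 0 <= s -> 0 <= t -> P (s + t) X = P s (P t X),
      forall X, P t X @[t --> 0^'+] --> X,
      forall t : R, 0 <= t -> completely_positive (P t)
    & forall t : R, 0 <= t -> P t 1%:M = 1%:M].

Definition generator n (P : R -> {linear 'M[C]_n -> 'M[C]_n})
    (L : 'M[C]_n -> 'M[C]_n) : Prop :=
  forall X, (t^-1)%:C *: (P t X - X) @[t --> 0^'+] --> L X.

Definition invariant_state n (P : R -> {linear 'M[C]_n -> 'M[C]_n})
    (rho : 'M[C]_n) : Prop :=
  state rho /\ forall t : R, 0 <= t -> hs_adj (P t) rho = rho.

Definition primitive n (P : R -> {linear 'M[C]_n -> 'M[C]_n})
    (sigma : 'M[C]_n) : Prop :=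
  [/\ invariant_state P sigma,
      forall rho, invariant_state P rho -> rho = sigma
    & \rank sigma = n].

Definition gns_detailed_balance n (sigma : 'M[C]_n)
    (L : 'M[C]_n -> 'M[C]_n) : Prop :=
  forall X Y, gns_dot sigma X (L Y) = gns_dot sigma (L X) Y.

Definition Gam n (sigma : 'M[C]_n) (s : R) (X : 'M[C]_n) : 'M[C]_n :=
  mxpowR sigma (s / 2) *m X *m mxpowR sigma (s / 2).

(* The trace of a positive semidefinite matrix is real, so Re loses nothing. *)
Definition Lpnorm n (sigma : 'M[C]_n) (p : R) (X : 'M[C]_n) : R :=
  (complex.Re (\tr (mxpowR (absmx (Gam sigma p^-1 X)) p))) `^ p^-1.

Definition hconj (p : R) : R := p / (p - 1).

Definition dirichlet n (sigma : 'M[C]_n) (L : 'M[C]_n -> 'M[C]_n) (p : R)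
    (X : 'M[C]_n) : C :=
  - (hconj p * p / 4)%:C *
    kms_dot sigma
      (Gam sigma (- (hconj p)^-1) (mxpowR (Gam sigma p^-1 X) (p - 1))) (L X).

Definition beckner n (sigma : 'M[C]_n) (L : 'M[C]_n -> 'M[C]_n)
    (p alpha : R) : Prop :=
  forall X : 'M[C]_n, pdmx X ->
    (alpha * hconj p * (Lpnorm sigma p X `^ p - Lpnorm sigma 1 X `^ p))%:C
      <= dirichlet sigma L p X.

(* Extended real: the supremum is +oo when n = 1. *)
Definition beckner_opt n (sigma : 'M[C]_n) (L : 'M[C]_n -> 'M[C]_n)
    (p : R) : \bar R :=
  ereal_sup [set alpha%:E | alpha in [set a : R | beckner sigma L p a]].

End Operators.

(* Main.v *)
Require Import Defs.
From HB Require Import structures.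
From mathcomp Require Import all_boot all_order all_algebra.
From mathcomp Require Import complex.
From mathcomp Require Import all_classical all_reals all_analysis.
From mathcomp Require Import ring lra.

Import Order.TTheory GRing.Theory Num.Theory.
Import numFieldNormedType.Exports.

Set Implicit Arguments.
Unset Strict Implicit.
Unset Printing Implicit Defensive.

(** Write t = 1/p. For X > 0 put Z = Gam^(1/p)(X), so X = Gam^(-1/p)(Z), and
    compare the exponents p <= q through Y = Gam^(-1/q)(Z^(p/q)), chosen so
    that |Y|_q^q = |X|_p^p = Tr Z^p. Writing p^ for p/(p-1), the chain
      a q^ (|X|_p^p - |X|_1^p) <= a q^ (|Y|_q^q - |Y|_1^q) <= E_q(Y) <= E_p(X)
    turns the inequality at q with constant a into the inequality at p with
    constant a q^/p^, which is the claim. It rests on two estimates.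

    The bound |Y|_1^q <= |X|_1^p ([Lpnorm1_power]) is an instance of Jensen's
    inequality: with s and z the eigenvalues of sigma and Z, both L1-norms are
    sums over pairs of eigenvectors, with weights the squared overlaps.

    The bound E_q(Y) <= E_p(X) ([stroock_varopoulos]) is a quantum
    Stroock-Varopoulos inequality. The operator A = Z^p is the same for X and
    Y, and
      E_p(X) = - 1/(4 t (1-t))
        Tr (A^(1-t) sigma^(t/2) L(sigma^(-t/2) A^t sigma^(-t/2)) sigma^(t/2)),
    so the claim is that the right-hand side is nondecreasing in t on
    [1/2, 1). Expand it over the coefficients
      C_(a,i),(b,j) = <f_i, L(|f_a><f_b|) f_j>
    of L in an eigenbasis f of sigma ([choi]). Four facts are used.
    - Complete positivity of P_t gives, in the limit of (P_t - id)/t, that C is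
      positive on the vectors c with sum_a c_(a,a) = 0 ([choi_generator_ge0]).
    - Detailed balance gives s_j C_(a,i),(b,j) = s_b C_(j,b),(i,a)
      ([choi_generator_gns]); used twice, it shows that C only couples pairs
      with the same ratio r = s_a/s_i, that is, that L commutes with the
      modular group ([T_freq]).
    - P_t(1) = 1 gives sum_a C_(a,i),(a,j) = 0 ([choi_generator_unital]).
    - With al_k the eigenvalues of A, x = al_k/r and y = al_l, the expansion is
      a sum of x^t y^(1-t) against coefficients indexed by (k, l, r). Detailed
      balance symmetrizes it in x and y, unitality allows adding the terms
      linear in x and in y, and E_p(X) becomes 1/8 of the sum of
        (x^t - y^t) (x^(1-t) - y^(1-t)) / (t (1-t))
      ([powform_dform]). The coefficient of every (k, l, r) is nonnegative,
      except possibly when k = l and r = 1, where x = y and the summand vanishes.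
    Thus the monotonicity in t is that of the displayed scalar function
    ([dform_nondecreasing]), which comes from the convexity of
    tau |-> cosh (u sqrt tau) ([cosh_convex_sqr]).

    The scalar function is nonnegative, hence so is E_p; so 0 is always an
    admissible constant, and negative constants do not matter for the optimal
    one ([beckner_opt_nonincreasing]). *)

(** * The scalar inequality *)

Section ScalarInequality.
Local Open Scope classical_set_scope.
Local Open Scope ring_scope.
Variable R : realType.
Implicit Types (a b c l m s t x y lam : R).

(** Induction on k: the difference of the two sides at k+1 is the one at k times
    lam a + (1 - lam) b, plus lam (1 - lam) (a - b) (a^k - b^k). *)
Lemma expr_convex lam a b k : 0 <= lam <= 1 -> 0 <= a -> 0 <= b ->
  (lam * a + (1 - lam) * b) ^+ k <= lam * a ^+ k + (1 - lam) * b ^+ k.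
Proof.
move=> /andP[lam0 lam1] a0 b0; elim: k => [|k IHk]; first by rewrite !expr0; lra.
have cab0 : 0 <= lam * a + (1 - lam) * b.
  by rewrite addr_ge0 ?mulr_ge0 ?subr_ge0.
rewrite exprS; apply: (le_trans (ler_wpM2l cab0 IHk)).
(* a - b and a^k - b^k have the same sign. *)
have cheb : 0 <= (a - b) * (a ^+ k - b ^+ k).
  have [ab|/ltW ba] := leP a b.
    by rewrite mulr_le0 ?subr_le0 // lerXn2r // nnegrE.
  by rewrite mulr_ge0 ?subr_ge0 // lerXn2r // nnegrE.
rewrite -subr_ge0 !exprS.
set A := a ^+ k in cheb *; set B := b ^+ k in cheb *.
have -> : lam * (a * A) + (1 - lam) * (b * B) -
   (lam * a + (1 - lam) * b) * (lam * A + (1 - lam) * B)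
   = lam * (1 - lam) * ((a - b) * (A - B)) by ring.
by apply: mulr_ge0 cheb; rewrite mulr_ge0 ?subr_ge0.
Qed.

(** Convexity of tau |-> cosh (sqrt tau): in the power series of 2 cosh only even
    powers survive, and each of them is a power of the square. *)
Lemma cosh_convex_sqr lam a b c : 0 <= lam <= 1 ->
  c ^+ 2 = lam * a ^+ 2 + (1 - lam) * b ^+ 2 ->
  expR c + expR (- c) <=
  lam * (expR a + expR (- a)) + (1 - lam) * (expR b + expR (- b)).
Proof.
move=> lam01 cE.
have cvE x : series (exp_coeff x) @ \oo --> expR x.
  exact: is_cvg_series_exp_coeff.
have cvS x : (fun N => series (exp_coeff x) N + series (exp_coeff (- x)) N) @ \oo
    --> expR x + expR (- x) by exact: cvgD.
have cvM k x : (fun N => k * (series (exp_coeff x) N + series (exp_coeff (- x)) N))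
    @ \oo --> k * (expR x + expR (- x)) by apply: cvgMr; exact: cvS.
apply: (ler_cvg_to (cvS c) (cvgD (cvM lam a) (cvM (1 - lam) b))).
apply: nearW => N /=.
rewrite /series /= !fctE /= -!big_split /= !mulr_sumr -big_split /=; apply: ler_sum => k _.
have coefE x : exp_coeff x k + exp_coeff (- x) k =
   (x ^+ k + (- x) ^+ k) / k`!%:R by rewrite [RHS]mulrDl.
rewrite !coefE !mulrA -[X in _ <= X]mulrDl; apply: ler_wpM2r; first by rewrite invr_ge0.
have oppE x : (- x) ^+ k = (-1) ^+ odd k * x ^+ k by rewrite signr_odd -exprNn.
rewrite !oppE.
case: (boolP (odd k)) => ok.
  by rewrite !expr1 !mulN1r !subrr !mulr0 addr0.
have evenE x : x ^+ k = (x ^+ 2) ^+ k./2.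
  by rewrite -exprM mul2n -[in LHS](odd_double_half k) (negbTE ok).
have := expr_convex k./2 lam01 (sqr_ge0 a) (sqr_ge0 b).
rewrite -cE -!evenE expr0 !mul1r; lra.
Qed.

(** For a classical reversible Markov chain, E_p is up to a constant the average
    over the jumps of this form between the values of X^p, with t = 1/p. *)
Definition dform (t x y : R) : R :=
  (x `^ t - y `^ t) * (x `^ (1 - t) - y `^ (1 - t)) / (t * (1 - t)).

(** Factoring out the geometric mean of x and y leaves a difference of two
    hyperbolic cosines over the difference 1 - c^2 of the squares of their
    arguments (up to v): a slope of tau |-> cosh (v sqrt tau) between c^2 and 1. *)
Lemma dform_cosh t x y : 0 < x -> 0 < y -> let v := (ln x - ln y) / 2 in
  let c := 2 * t - 1 in
  dform t x y = 4 * expR ((ln x + ln y) / 2) *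
    ((expR v + expR (- v)) - (expR (c * v) + expR (- (c * v)))) / (1 - c ^+ 2).
Proof.
move=> x0 y0 v c; rewrite /dform.
have tE : t * (1 - t) = (1 - c ^+ 2) / 4 by rewrite /c; field.
have pE z s : 0 < z -> z `^ s = expR (s * ln z) by move=> z0; rewrite /powR gt_eqF.
rewrite tE !pE // invf_div [LHS]mulrA; congr (_ / _).
rewrite -[RHS]mulrA [RHS]mulrC; congr (_ * 4).
set h := (ln x + ln y) / 2.
have prodE u w r : u + w = h + r -> expR u * expR w = expR h * expR r.
  by move=> uwE; rewrite -!expRD uwE.
transitivity (expR (t * ln x) * expR ((1 - t) * ln x)
    + expR (t * ln y) * expR ((1 - t) * ln y)
    - expR (t * ln x) * expR ((1 - t) * ln y)
    - expR (t * ln y) * expR ((1 - t) * ln x)); first by ring.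
rewrite (prodE (t * ln x) ((1 - t) * ln x) v); last by rewrite /h /v; field.
rewrite (prodE (t * ln y) ((1 - t) * ln y) (- v)); last by rewrite /h /v; field.
rewrite (prodE (t * ln x) _ (c * v)); last by rewrite /h /v /c; field.
rewrite (prodE (t * ln y) _ (- (c * v))); last by rewrite /h /v /c; field.
ring.
Qed.

(** Slopes of a convex function towards the fixed end point tau = 1 increase
    with the other end point. *)
Lemma dform_nondecreasing s t x y : 2^-1 <= s -> s <= t -> t < 1 ->
  0 < x -> 0 < y -> dform s x y <= dform t x y.
Proof.
move=> s2 st t1 x0 y0; rewrite !dform_cosh //=.
set v := (_ - _) / 2; set c := 2 * s - 1; set d := 2 * t - 1.
have c0 : 0 <= c by rewrite /c; lra.
have cd : c <= d by rewrite /c /d; lra.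
have d1 : d < 1 by rewrite /d; lra.
have c2 : 0 < 1 - c ^+ 2 by nra.
have d2 : 0 < 1 - d ^+ 2 by nra.
have cd2 : c ^+ 2 <= d ^+ 2 by rewrite lerXn2r ?nnegrE //; lra.
(* The weight for which d^2 is the barycentre of c^2 and 1. *)
pose lam := (1 - d ^+ 2) / (1 - c ^+ 2).
have lam01 : 0 <= lam <= 1.
  rewrite /lam divr_ge0 ?(ltW c2) ?(ltW d2) //= ler_pdivrMr // mul1r; lra.
have dE : (d * v) ^+ 2 = lam * (c * v) ^+ 2 + (1 - lam) * v ^+ 2.
  by rewrite /lam; field; rewrite gt_eqF.
have := cosh_convex_sqr lam01 dE.
set Ed := expR (d * v) + _; set Ec := expR (c * v) + _; set E1 := expR v + _.
move=> ineq.
rewrite -!mulrA !(ler_pM2l, expR_gt0) ?mulr_gt0 // ler_pdivlMr // mulrAC.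
rewrite -mulrA -/lam mulrC; lra.
Qed.

Lemma dform_ge0 t x y : 0 < t < 1 -> 0 < x -> 0 < y -> 0 <= dform t x y.
Proof.
move=> /andP[t0 t1] x0 y0; have t1' : 0 < 1 - t by rewrite subr_gt0.
apply: divr_ge0; last by rewrite mulr_ge0 ?ltW.
have mono s u w : 0 < s -> 0 <= u -> u <= w -> u `^ s <= w `^ s.
  move=> s0 u0 uw; apply: ge0_ler_powR; rewrite ?nnegrE ?(ltW s0) //.
  exact: le_trans uw.
have [xy|/ltW yx] := leP x y.
  by rewrite mulr_le0 ?subr_le0 //; apply: mono; rewrite // ltW.
by rewrite mulr_ge0 ?subr_ge0 //; apply: mono; rewrite // ltW.
Qed.

Lemma powR_young s x y : 0 < s <= 1 -> 0 < x -> 0 < y ->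
  x `^ s * y `^ (1 - s) <= s * x + (1 - s) * y.
Proof.
move=> /andP[s0 s1] x0 y0.
have [->|sn1] := eqVneq s 1.
  by rewrite subrr powRr0 mulr1 powRr1 ?(ltW x0) // mul1r mul0r addr0.
have s1' : s < 1 by rewrite lt_neqAle sn1.
have := @conjugate_powR R (x `^ s) (y `^ (1 - s)) s^-1 (1 - s)^-1
  (powR_ge0 _ _) (powR_ge0 _ _).
rewrite !invr_gt0 !invrK -!powRrM !mulfV ?subr_eq0 ?gt_eqF // ?powRr1 ?(ltW x0) ?(ltW y0) //.
rewrite subr_gt0 => /(_ s0 s1'); rewrite [s + _]addrC subrK => /(_ erefl).
by rewrite [x * s]mulrC [y * _]mulrC.
Qed.

End ScalarInequality.

(** * Functional calculus in a unitary eigenbasis *)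

Section FunctionalCalculus.
Local Open Scope complex_scope.
Local Open Scope sesquilinear_scope.
Local Open Scope ring_scope.
Variable R : realType.
Local Notation C := R[i].

(** Self-adjoint operators are handled through a chosen spectral decomposition,
    with real eigenvalues; the rows of V are the adjoints of the eigenvectors. *)
Definition udiag n (V : 'M[C]_n) (d : 'I_n -> R) : 'M[C]_n :=
  V^t* *m diag_mx (\row_i (d i)%:C) *m V.

Lemma conjC_real_complex (x : R) : (x%:C)^* = x%:C :> C.
Proof. by rewrite conj_Creal //; apply/complex_realP; exists x. Qed.

Lemma conjC_realM (x : R) (z : C) : (x%:C * z)^* = x%:C * z^*.
Proof. by rewrite rmorphM; congr (_ * _); exact: conjC_real_complex. Qed.

Lemma hermsymmxP n (A : 'M[C]_n) : reflect (A^t* = A) (A \is hermsymmx).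
Proof.
rewrite is_hermitianmxE expr0 scale1r eq_sym; exact: eqP.
Qed.

Lemma trmxC_mul m n p (A : 'M[C]_(m, n)) (B : 'M[C]_(n, p)) :
  (A *m B)^t* = B^t* *m A^t*.
Proof. by rewrite trmx_mul map_mxM. Qed.

Lemma udiagE n (V : 'M[C]_n) d a b :
  udiag V d a b = \sum_k (V k a)^* * (d k)%:C * V k b.
Proof.
by rewrite !mxE; apply: eq_bigr => k _; rewrite mul_mx_diag !mxE.
Qed.

Lemma udiag_herm n (V : 'M[C]_n) d : (udiag V d)^t* = udiag V d.
Proof.
rewrite /udiag !trmxC_mul trmxCK mulmxA tr_diag_mx map_diag_mx.
suff -> : map_mx Num.conj (\row_i (d i)%:C) = \row_i (d i)%:C :> 'rV[C]_n by [].
by apply/rowP => i; rewrite !mxE; exact: conjC_real_complex.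
Qed.

Lemma unitarymxC n (V : 'M[C]_n) : V \is unitarymx -> V^t* *m V = 1%:M.
Proof. by move=> uV; rewrite -invmx_unitary // mulVmx // unitarymx_unit. Qed.

Lemma mulmx_udiag n (V : 'M[C]_n) d e : V \is unitarymx ->
  udiag V d *m udiag V e = udiag V (fun i => d i * e i).
Proof.
move=> uV; rewrite /udiag -!mulmxA (mulmxA V) (unitarymxP uV) mul1mx.
rewrite (mulmxA (diag_mx _)) mulmx_diag; congr (_ *m (diag_mx _ *m _)).
by apply/rowP => i; rewrite !mxE rmorphM.
Qed.

Lemma udiag1 n (V : 'M[C]_n) : V \is unitarymx -> udiag V (fun=> 1) = 1%:M.
Proof.
move=> uV; rewrite /udiag [diag_mx _](_ : _ = 1%:M) ?mulmx1 ?unitarymxC //.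
by rewrite -diag_const_mx; congr diag_mx; apply/rowP => i; rewrite !mxE.
Qed.

Lemma mxtrace_udiag n (V : 'M[C]_n) d : V \is unitarymx ->
  \tr (udiag V d) = (\sum_i d i)%:C.
Proof.
move=> uV; rewrite /udiag -mulmxA mxtrace_mulC -mulmxA (unitarymxP uV) mulmx1.
by rewrite mxtrace_diag rmorph_sum; apply: eq_bigr => i _; rewrite mxE.
Qed.

(** The functional calculus does not depend on the diagonalization: a unitary
    intertwining two real diagonal matrices has zero entries between different
    eigenvalues, so it also intertwines their images under f. *)
Lemma mxfun_udiag (f : R -> R) n (V : 'M[C]_n) d : V \is unitarymx ->
  mxfun f (udiag V d) = udiag V (f \o d).
Proof.
move=> uV; set A := udiag V d.
have /hermitian_normalmx/orthomx_spectralP : A \is hermsymmx.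
  by apply/hermsymmxP; rewrite udiag_herm.
rewrite /mxfun; set P := spectralmx A; set sp := spectral_diag A => AE.
have uP : P \is unitarymx by exact: spectral_unitarymx.
have Pu := unitarymx_unit uP.
set fsp := map_mx _ sp.
have TE : diag_mx sp *m (P *m V^t*) = P *m V^t* *m diag_mx (\row_i (d i)%:C).
  transitivity (P *m A *m V^t*).
    by rewrite AE -!mulmxA (mulKVmx Pu).
  by rewrite /A /udiag -!mulmxA (unitarymxP uV) mulmx1.
have fTE : diag_mx fsp *m (P *m V^t*) = P *m V^t* *m diag_mx (\row_i (f (d i))%:C).
  apply/matrixP => i j; move/matrixP/(_ i j): TE.
  rewrite !mul_diag_mx !mul_mx_diag !mxE; set t := (\sum_k _).
  have [->|t0] := eqVneq t 0; first by rewrite !(mulr0, mul0r).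
  by rewrite [t * _]mulrC => /(mulIf t0) ->; rewrite [RHS]mulrC.
rewrite /udiag (invmx_unitary uP) /= -[LHS]mulmx1 -(unitarymxC uV).
rewrite -!mulmxA (mulmxA P) (mulmxA _ _ V) fTE.
by rewrite -!mulmxA (mulmxA _ P) (unitarymxC uP) mul1mx.
Qed.

Lemma hermsymmx_udiag n (A : 'M[C]_n) : A \is hermsymmx ->
  exists V : 'M[C]_n, exists2 d : 'I_n -> R, V \is unitarymx & A = udiag V d.
Proof.
move=> hA; have := hA => /hermitian_normalmx/orthomx_spectralP AE.
move: (spectralmx A) (spectral_unitarymx A) (spectral_diag A)
  (hermitian_spectral_diag_real hA) AE => P uP sp /mxOverP spR AE.
exists P, (fun i => complex.Re (sp 0 i)); first exact: uP.
rewrite AE (invmx_unitary uP) /udiag.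
have spE : sp = \row_i (complex.Re (sp 0 i))%:C.
  by apply/rowP => i; rewrite !mxE RRe_real.
by rewrite {1}spE.
Qed.

Lemma udiag_form n (V : 'M[C]_n) d (v : 'cV[C]_n) :
  (v^t* *m udiag V d *m v) 0 0 = \sum_k (d k)%:C * `|(V *m v) k 0| ^+ 2.
Proof.
rewrite /udiag !mulmxA -trmxC_mul -!mulmxA mul_diag_mx mxE; apply: eq_bigr => k _.
by rewrite !mxE normCK mulrCA [_^* * _]mulrC.
Qed.

(** Test the form on the k-th eigenvector. *)
Lemma udiag_psdmx n (V : 'M[C]_n) d : V \is unitarymx ->
  psdmx (udiag V d) -> forall k, 0 <= d k.
Proof.
move=> uV [_ /= pA] k; have := pA (V^t* *m delta_mx k 0).
rewrite udiag_form mulmxA (unitarymxP uV) mul1mx (bigD1 k) //= big1.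
  by rewrite addr0 !mxE !eqxx normr1 expr1n mulr1 ler0c.
by move=> j /negbTE jk; rewrite !mxE jk normr0 expr0n mulr0.
Qed.

Lemma udiag_pdmx n (V : 'M[C]_n) d : V \is unitarymx ->
  pdmx (udiag V d) <-> (forall k, 0 < d k).
Proof.
move=> uV; split=> [[_ /= pA] k | d0].
  have := pA (V^t* *m delta_mx k 0).
  rewrite udiag_form mulmxA (unitarymxP uV) mul1mx (bigD1 k) //= big1.
    rewrite addr0 !mxE !eqxx normr1 expr1n mulr1 ltcR; apply.
    apply/negP => /eqP/(congr1 (mulmx V)).
    rewrite mulmxA (unitarymxP uV) mul1mx mulmx0 => /matrixP/(_ k 0)/eqP.
    by rewrite !mxE !eqxx oner_eq0.
  by move=> j /negbTE jk; rewrite !mxE jk normr0 expr0n mulr0.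
split; first by apply/hermsymmxP; rewrite udiag_herm.
move=> v v0; rewrite udiag_form lt_def sumr_ge0 ?andbT; last first.
  by move=> k _; rewrite mulr_ge0 ?exprn_ge0 // ler0c ltW.
apply: contra v0; rewrite psumr_eq0; last first.
  by move=> k _; rewrite mulr_ge0 ?exprn_ge0 // ler0c ltW.
move=> /allP Vv0; suff: V *m v == 0.
  by move=> /eqP/(congr1 (mulmx (V^t*))); rewrite mulmxA unitarymxC // mul1mx mulmx0 => ->.
apply/eqP/matrixP => k j; rewrite ord1 [RHS]mxE; apply/eqP.
have := Vv0 k (mem_index_enum _); rewrite mulf_eq0 expf_eq0 normr_eq0 /=.
by rewrite (_ : (d k)%:C == 0 = false) //; apply/negbTE; rewrite eq_complex /= gt_eqF.
Qed.

Lemma pdmxP n (A : 'M[C]_n) : pdmx A ->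
  exists V : 'M[C]_n, exists2 d : 'I_n -> R, V \is unitarymx /\ (forall i, 0 < d i)
    & A = udiag V d.
Proof.
move=> pA; have [V [d uV AE]] := hermsymmx_udiag pA.1.
exists V, d; last exact: AE.
by split; [exact: uV | apply/(udiag_pdmx _ uV); rewrite -AE].
Qed.

Lemma psdmx_full_rank n (A : 'M[C]_n) : psdmx A -> \rank A = n ->
  exists V : 'M[C]_n, exists2 d : 'I_n -> R, V \is unitarymx /\ (forall i, 0 < d i)
    & A = udiag V d.
Proof.
move=> pA rA; have [V [d uV AE]] := hermsymmx_udiag pA.1.
exists V, d; last exact: AE.
split; [exact: uV | move=> k].
have Au : A \in unitmx by rewrite -row_free_unit /row_free rA.
rewrite lt_def (udiag_psdmx uV) ?andbT -?AE //; apply/eqP => dk0.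
have : A *m (V^t* *m delta_mx k 0 : 'cV_n) = 0.
  rewrite AE /udiag -!mulmxA (mulmxA V) (unitarymxP uV) mul1mx.
  rewrite [diag_mx _ *m _](_ : _ = 0) ?mulmx0 //.
  apply/matrixP => i j; rewrite mul_diag_mx !mxE.
  by case: eqP => [->|_]; rewrite ?dk0 ?mul0r ?mulr0.
move=> /(congr1 (mulmx (invmx A))); rewrite mulKmx // mulmx0.
move=> /(congr1 (mulmx V)); rewrite mulmxA (unitarymxP uV) mul1mx mulmx0.
by move=> /matrixP/(_ k 0)/eqP; rewrite !mxE !eqxx oner_eq0.
Qed.

Lemma pdmx_congr n (S X : 'M[C]_n) : S \is hermsymmx -> S \in unitmx ->
  pdmx X -> pdmx (S *m X *m S).
Proof.
move=> /hermsymmxP hS uS [/hermsymmxP hX pX]; split.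
  by apply/hermsymmxP; rewrite !trmxC_mul hS hX mulmxA.
move=> v v0; rewrite -{1}hS !mulmxA -trmxC_mul -!mulmxA mulmxA; apply: pX.
by apply: contra v0 => /eqP Sv; rewrite -[v](mulKmx uS) Sv mulmx0.
Qed.

Lemma absmx_udiag n (V : 'M[C]_n) d : V \is unitarymx -> (forall i, 0 <= d i) ->
  absmx (udiag V d) = udiag V d.
Proof.
move=> uV d0; rewrite /absmx udiag_herm mulmx_udiag // mxfun_udiag //.
by congr udiag; apply/funext => i /=; rewrite -expr2 sqrtr_sqr ger0_norm.
Qed.

End FunctionalCalculus.

(** * Completely positive maps on rank-one operators *)

Section Choi.
Local Open Scope complex_scope.
Local Open Scope sesquilinear_scope.
Local Open Scope ring_scope.
Variable R : realType.
Local Notation C := R[i].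

Lemma psdmx_gram m n (W : 'M[C]_(m, n)) : psdmx (W *m W^t*).
Proof.
split; first by apply/hermsymmxP; rewrite trmxC_mul trmxCK.
move=> v; rewrite !mulmxA -[_ *m v]mulmxA.
have -> : W^t* *m v = (v^t* *m W)^t* by rewrite trmxC_mul trmxCK.
by rewrite mxE sumr_ge0 // => k _; rewrite !mxE -normCK exprn_ge0.
Qed.

Lemma trmxC_mxcol n m k (f : 'I_k -> 'M[C]_(n, m)) :
  (\mxcol_a f a)^t* = \mxrow_a (f a)^t*.
Proof. by apply/matrixP => i j; rewrite !mxE. Qed.

Lemma trmxC_mxblock n k (X : 'I_k -> 'I_k -> 'M[C]_n) :
  (\mxblock_(a, b) X a b)^t* = \mxblock_(a, b) (X b a)^t*.
Proof. by apply/matrixP => i j; rewrite !mxE. Qed.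

(** The block matrix with blocks |f_a><f_b| is the projection, up to scale, on
    the line of the concatenated vector. *)
Lemma psdmx_outer_blocks n k (f : 'I_k -> 'cV[C]_n) :
  psdmx (\mxblock_(a < k, b < k) (f a *m (f b)^t*)).
Proof.
have -> : \mxblock_(a < k, b < k) (f a *m (f b)^t*) =
  (\mxcol_a f a) *m (\mxcol_a f a)^t*.
  by rewrite trmxC_mxcol mul_mxcol_mxrow.
exact: psdmx_gram.
Qed.

Lemma cp_outer_ge0 n (Phi : 'M[C]_n -> 'M[C]_n) k (f v : 'I_k -> 'cV[C]_n) :
  completely_positive Phi ->
  0 <= (\sum_a \sum_b (v a)^t* *m Phi (f a *m (f b)^t*) *m v b) 0 0.
Proof.
move=> cpPhi; have [_ /(_ (\mxcol_a v a))] := cpPhi _ _ (psdmx_outer_blocks f).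
rewrite trmxC_mxcol mul_mxrow_mxblock mul_mxrow_mxcol.
under eq_bigr do rewrite mulmx_suml.
by rewrite exchange_big.
Qed.

(** A completely positive map preserves adjoints. The blocks for the pair (f, g)
    form a self-adjoint matrix, and this is its off-diagonal block. *)
Lemma cp_outer_herm n (Phi : 'M[C]_n -> 'M[C]_n) (f g : 'cV[C]_n) :
  completely_positive Phi ->
  (Phi (f *m g^t*))^t* = Phi (g *m f^t*).
Proof.
pose h (a : 'I_2) := if a == 0 then f else g.
move=> cpPhi; have [/hermsymmxP + _] := cpPhi _ _ (psdmx_outer_blocks h).
rewrite trmxC_mxblock => /eq_mxblockP/(_ 1 0).
by [].
Qed.
End Choi.

(** * Limits of complex numbers *)

Section ComplexLimits.
Local Open Scope classical_set_scope.
Local Open Scope complex_scope.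
Local Open Scope sesquilinear_scope.
Local Open Scope ring_scope.
Variable R : realType.
Local Notation C := R[i].
Context (T : Type) (F : set_system T) {FF : ProperFilter F}.

Lemma cvgC_sum (I : Type) (r : seq I) (f : I -> T -> C) (l : I -> C) :
  (forall i, (f i t : C^o) @[t --> F] --> (l i : C^o)) ->
  ((\sum_(i <- r) f i t) : C^o) @[t --> F] --> ((\sum_(i <- r) l i) : C^o).
Proof.
by move=> fl; apply: cvg_big => [|i _]; [exact: add_continuous | exact: fl].
Qed.

Lemma cvg_mxtrace_mul n (G : 'M[C]_n) (f : T -> 'M[C]_n) (l : 'M[C]_n) :
  f @ F --> l -> (\tr (G *m f t) : C^o) @[t --> F] --> (\tr (G *m l) : C^o).
Proof.
move=> fl; rewrite /mxtrace.
apply: cvgC_sum => i; rewrite mxE; under eq_fun do rewrite mxE.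
apply: cvgC_sum => j; apply: cvgMr.
exact: (cvg_comp _ _ fl (@coord_continuous C n n j i l)).
Qed.

Lemma cvgC_unique (f : T -> C) (l m : C) :
  (f t : C^o) @[t --> F] --> (l : C^o) -> (f t : C^o) @[t --> F] --> (m : C^o) -> l = m.
Proof. by move=> fl fm; exact: (cvg_unique (@norm_hausdorff _ C^o) fl fm). Qed.

(** Nonnegativity of a complex number is the closed condition `|z| = z. *)
Lemma cvgC_ge0 (f : T -> C) (l : C) :
  (\forall t \near F, 0 <= f t) -> (f t : C^o) @[t --> F] --> (l : C^o) -> 0 <= l.
Proof.
move=> f0 fl; rewrite ger0_def; apply/eqP.
apply: (cvgC_unique _ fl); apply: cvg_trans (cvg_norm fl).
by apply: near_eq_cvg; near do rewrite ger0_norm //.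
Unshelve. all: by end_near. Qed.

Lemma cvgC_conj (f : T -> C) (l : C) :
  (f t : C^o) @[t --> F] --> (l : C^o) -> ((f t)^* : C^o) @[t --> F] --> (l^* : C^o).
Proof.
move=> /cvgrPdist_lt fl; apply/cvgrPdist_lt => e e0.
by near=> t; rewrite -rmorphB norm_conjC; near: t; exact: fl.
Unshelve. all: by end_near. Qed.

End ComplexLimits.

(** * Coefficients of the generator in an orthonormal basis *)

Section Generator.
Local Open Scope classical_set_scope.
Local Open Scope complex_scope.
Local Open Scope sesquilinear_scope.
Local Open Scope ring_scope.
Variable R : realType.
Local Notation C := R[i].

Lemma trmxCZ m n (a : C) (A : 'M[C]_(m, n)) : (a *: A)^t* = a^* *: A^t*.
Proof. by apply/matrixP => i j; rewrite !mxE rmorphM. Qed.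

(** Identities between operators are obtained from limits of complex numbers by
    pairing both sides with every G. *)
Lemma mxtrace_mul_inj n (M N : 'M[C]_n) :
  (forall G : 'M[C]_n, \tr (G *m M) = \tr (G *m N)) -> M = N.
Proof.
move=> MN; apply/matrixP => i j; have := MN (delta_mx j i).
have trE (A : 'M[C]_n) : \tr (delta_mx j i *m A) = A i j.
  rewrite /mxtrace (bigD1 j) //= big1 => [|k /negbTE kj].
    rewrite addr0 mxE (bigD1 i) //= big1 => [|l /negbTE li].
      by rewrite mxE !eqxx mul1r addr0.
    by rewrite mxE eqxx li mul0r.
  by rewrite mxE big1 // => l _; rewrite mxE kj mul0r.
by rewrite !trE.
Qed.

Section Basis.
Variables (n : nat) (U : 'M[C]_n).
Hypothesis uU : U \is unitarymx.

Definition bvec (a : 'I_n) : 'cV[C]_n := col a (U^t*).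

(** Matrix coefficients <f_i, Phi(|f_a><f_b|) f_j> for x = (a, i), y = (b, j),
    in the basis f = [bvec] of columns of the adjoint of U. *)
Definition choi (Phi : 'M[C]_n -> 'M[C]_n) (x y : 'I_n * 'I_n) : C :=
  \tr (bvec y.2 *m (bvec x.2)^t* *m Phi (bvec x.1 *m (bvec y.1)^t*)).

Lemma bvec_dot a b : (bvec a)^t* *m bvec b = (a == b)%:R%:M.
Proof.
apply/matrixP => i j; rewrite !ord1 [RHS]mxE eqxx mulr1n.
have /matrixP/(_ a b) := unitarymxP uU; rewrite [X in _ = X]mxE => <-.
by rewrite !mxE; apply: eq_bigr => k _; rewrite !mxE conjCK.
Qed.

Lemma bvec_complete : \sum_a bvec a *m (bvec a)^t* = 1%:M.
Proof.
rewrite -(unitarymxC uU); apply/matrixP => i j; rewrite summxE mxE.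
by apply: eq_bigr => a _; rewrite mxE big_ord1 !mxE conjCK.
Qed.

Lemma udiag_bvec d a : udiag U d *m bvec a = (d a)%:C *: bvec a.
Proof.
rewrite /bvec colE /udiag -!mulmxA (mulmxA U) (unitarymxP uU) mul1mx scalemxAr.
congr (_ *m _); apply/matrixP => i j; rewrite mul_diag_mx !mxE.
by case: eqP => [->|_]; rewrite ?mulr0.
Qed.

Lemma mxtrace_outer (u v : 'cV[C]_n) (M : 'M[C]_n) :
  \tr (u *m v^t* *m M) = (v^t* *m M *m u) 0 0.
Proof. by rewrite -mulmxA mxtrace_mulC -[LHS]mulr1n /mxtrace big_ord1. Qed.

(** The Choi matrix of a completely positive map is positive: the family of
    rank-one operators |f_a><f_b| is repeated once for every index i. *)
Lemma cp_choi_ge0 Phi (c : 'I_n * 'I_n -> C) : completely_positive Phi ->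
  0 <= \sum_x \sum_y (c x)^* * choi Phi x y * c y.
Proof.
move=> cpPhi; pose I : finType := ('I_n * 'I_n)%type.
have := cp_outer_ge0 (fun k : 'I_#|I| => bvec (enum_val k).1)
  (fun k : 'I_#|I| => c (enum_val k) *: bvec (enum_val k).2) cpPhi.
congr (0 <= _).
have bij_ev : {on predT, bijective (@enum_val I predT)}.
  exact/onW_bij/enum_val_bij.
rewrite [RHS](reindex _ bij_ev) summxE; apply: eq_bigr => k _.
rewrite [RHS](reindex _ bij_ev) summxE; apply: eq_bigr => l _.
rewrite /choi mxtrace_outer trmxCZ -!scalemxAl -scalemxAr !mxE.
by rewrite [_ * c _]mulrC mulrCA.
Qed.

Lemma cp_choi_conj Phi x y : completely_positive Phi ->
  (choi Phi x y)^* = choi Phi y x.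
Proof.
move=> cpPhi; rewrite /choi -mxtrace_tr -trace_map_mx trmxC_mul cp_outer_herm //.
by rewrite mxtrace_mulC trmxC_mul trmxCK.
Qed.

(** The Choi matrix of the identity is the projection, up to scale, on the vector
    supported by the pairs (a, a). This is why only the vectors orthogonal to it
    see a positive form in the limit. *)
Lemma choi_id x y : choi id x y = (x.1 == x.2)%:R * (y.1 == y.2)%:R.
Proof.
rewrite /choi mulmxA -(mulmxA (bvec y.2)) bvec_dot mul_mx_scalar -scalemxAl mxtraceZ.
rewrite mxtrace_mulC bvec_dot mxtrace_scalar mulr1n eq_sym; congr (_ * _).
Qed.

Variables (P : R -> {linear 'M[C]_n -> 'M[C]_n}) (L : 'M[C]_n -> 'M[C]_n).
Hypotheses (hP : qms P) (hL : generator P L).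

Definition diffquot (t : R) (X : 'M[C]_n) := (t^-1)%:C *: (P t X - X).

Lemma cvg_diffquot G X :
  (\tr (G *m diffquot t X) : C^o) @[t --> 0^'+] --> (\tr (G *m L X) : C^o).
Proof. by apply: cvg_mxtrace_mul; exact: hL. Qed.

Lemma choi_diffquot t x y :
  choi (diffquot t) x y = (t^-1)%:C * (choi (P t) x y - choi id x y).
Proof. by rewrite /choi /diffquot -scalemxAr mxtraceZ mulmxBr raddfB. Qed.

Lemma cvg_choi x y :
  (choi (diffquot t) x y : C^o) @[t --> 0^'+] --> (choi L x y : C^o).
Proof. exact: cvg_diffquot. Qed.

Lemma generator_linear a X Y : L (a *: X + Y) = a *: L X + L Y.
Proof.
apply: mxtrace_mul_inj => G; apply: (cvgC_unique (@cvg_diffquot G _)).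
rewrite mulmxDr -scalemxAr mxtraceD mxtraceZ.
under eq_fun => t.
  have -> : diffquot t (a *: X + Y) = a *: diffquot t X + diffquot t Y.
    rewrite /diffquot linearP scalerA mulrC -scalerA -scalerDr; congr (_ *: _).
    by rewrite scalerBr addrACA opprD.
  rewrite mulmxDr -scalemxAr mxtraceD mxtraceZ; over.
apply: cvgD; last exact: (@cvg_diffquot _ _).
by apply: cvgMr; exact: (@cvg_diffquot _ _).
Qed.

Lemma generator1 : L 1%:M = 0.
Proof.
have [_ _ _ _ P1] := hP.
apply: mxtrace_mul_inj => G; apply: (cvgC_unique (@cvg_diffquot G _)).
rewrite mulmx0 mxtrace0; apply: cvg_near_cst; near=> t.
by rewrite /diffquot P1 ?subrr ?scaler0 ?mulmx0 ?mxtrace0.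
Unshelve. all: by end_near. Qed.

Lemma choi_generator_conj x y : (choi L x y)^* = choi L y x.
Proof.
have [_ _ _ cpP _] := hP.
apply: (cvgC_unique (cvgC_conj (@cvg_choi x y))).
apply: cvg_trans (@cvg_choi y x); apply: near_eq_cvg; near=> t.
have t0 : 0 <= t by near: t; exact: nbhs_right_ge.
rewrite !choi_diffquot.
have -> : (choi (P t) y x - choi id y x)%R = (choi (P t) x y - choi id x y)^*.
  rewrite rmorphB /= cp_choi_conj; last exact: cpP.
  by congr (_ - _); rewrite !choi_id rmorphM !rmorph_nat mulrC.
by rewrite conjC_realM.
Unshelve. all: by end_near. Qed.

(** Conditional complete positivity: on these vectors the form of the difference
    quotient (P_t - id)/t is that of P_t/t. *)
Lemma choi_generator_ge0 (c : 'I_n * 'I_n -> C) : \sum_a c (a, a) = 0 ->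
  0 <= \sum_x \sum_y (c x)^* * choi L x y * c y.
Proof.
move=> c0; have [_ _ _ cpP _] := hP.
have cv : (\sum_x \sum_y (c x)^* * choi (diffquot t) x y * c y : C^o) @[t --> 0^'+]
    --> (\sum_x \sum_y (c x)^* * choi L x y * c y : C^o).
  apply: cvgC_sum => x; apply: cvgC_sum => y; apply: cvgMl; apply: cvgMr.
  exact: cvg_choi.
apply: (cvgC_ge0 _ cv).
near=> t.
have t0 : 0 < t by near: t; exact: nbhs_right_gt.
have -> : \sum_x \sum_y (c x)^* * choi (diffquot t) x y * c y =
  (t^-1)%:C * (\sum_x \sum_y (c x)^* * choi (P t) x y * c y
             - \sum_x \sum_y (c x)^* * choi id x y * c y).
  rewrite -sumrB mulr_sumr; apply: eq_bigr => x _.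
  rewrite -sumrB mulr_sumr; apply: eq_bigr => y _.
  by rewrite choi_diffquot; ring.
have -> : \sum_x \sum_y (c x)^* * choi id x y * c y = 0.
  transitivity ((\sum_a c (a, a))^* * \sum_a c (a, a)); last by rewrite c0 mulr0.
  rewrite rmorph_sum mulr_suml.
  transitivity (\sum_a \sum_b (c (a, a))^* * c (b, b)); last first.
    by apply: eq_bigr => a _; rewrite mulr_sumr.
  have diagE (F : 'I_n * 'I_n -> C) :
      \sum_x F x * (x.1 == x.2)%:R = \sum_a F (a, a).
    transitivity (\sum_a \sum_i F (a, i) * (a == i)%:R).
      by rewrite pair_bigA /=; apply: eq_bigr => -[a i] _.
    apply: eq_bigr => a _; rewrite (bigD1 a) //= eqxx mulr1 big1 ?addr0 // => i.
    by rewrite eq_sym => /negbTE ->; rewrite mulr0.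
  rewrite -(diagE (fun x => \sum_b (c x)^* * c (b, b))); apply: eq_bigr => x _.
  rewrite -(diagE (fun y => (c x)^* * c y)) mulr_suml; apply: eq_bigr => y _.
  by rewrite choi_id; ring.
rewrite subr0 mulr_ge0 ?ler0c ?invr_ge0 ?(ltW t0) //.
by apply/cp_choi_ge0/cpP/ltW.
Unshelve. all: by end_near. Qed.

(** Coefficient form of L(1) = 0. *)
Lemma choi_generator_unital i j : \sum_a choi L (a, i) (a, j) = 0.
Proof.
have sumL (f : 'I_n -> 'M[C]_n) : \sum_a L (f a) = L (\sum_a f a).
  have LD X Y : L (X + Y) = L X + L Y by have := generator_linear 1 X Y; rewrite !scale1r.
  have L0 : L 0 = 0 by apply: (addIr (L 0)); rewrite -LD !add0r.
  by rewrite (big_morph L LD L0).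
by rewrite /choi /= -raddf_sum -mulmx_sumr sumL bvec_complete generator1 mulmx0 raddf0.
Qed.

(** Detailed balance tested on |f_i><f_j| and |f_a><f_b|; since L preserves
    adjoints, the right-hand side is again a coefficient of L. *)
Lemma choi_generator_gns d a i b j : gns_detailed_balance (udiag U d) L ->
  (d j)%:C * choi L (a, i) (b, j) = (d b)%:C * choi L (j, b) (i, a).
Proof.
move=> /(_ (bvec i *m (bvec j)^t*) (bvec a *m (bvec b)^t*)); rewrite /gns_dot.
rewrite trmxC_mul trmxCK (mulmxA _ (bvec j)) udiag_bvec -!scalemxAl mxtraceZ.
rewrite -/(choi L (a, i) (b, j)) => ->.
have adj_bvec : (bvec b)^t* *m udiag U d = (d b)%:C *: (bvec b)^t*.
  by rewrite -(udiag_herm U d) -trmxC_mul udiag_bvec trmxCZ conjC_real_complex.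
rewrite -(choi_generator_conj (i, a)) /choi /= -[in RHS]mxtrace_tr -trace_map_mx.
rewrite !trmxC_mul trmxCK -mulmxA mxtrace_mulC -!mulmxA adj_bvec -!scalemxAr.
by rewrite mxtraceZ.
Qed.

End Basis.
End Generator.

(** * The quadratic form of a generator in detailed balance *)

Section ModularForm.
Local Open Scope complex_scope.
Local Open Scope sesquilinear_scope.
Local Open Scope ring_scope.
Variable R : realType.
Local Notation C := R[i].
Variables (n : nat) (d : 'I_n -> R) (V : 'M[C]_n).
Variable T : 'I_n * 'I_n -> 'I_n * 'I_n -> C.
Hypothesis d0 : forall a, 0 < d a.
Hypothesis uV : V \is unitarymx.
Hypothesis T_ge0 : forall c : 'I_n * 'I_n -> C, \sum_a c (a, a) = 0 ->
  0 <= \sum_x \sum_y (c x)^* * T x y * c y.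
Hypothesis T_gns : forall a i b j,
  (d j)%:C * T (a, i) (b, j) = (d b)%:C * T (j, b) (i, a).
Hypothesis T_unital : forall i j, \sum_a T (a, i) (a, j) = 0.

(** Ratio of eigenvalues: |f_a><f_i| is an eigenvector of the modular operator
    X |-> sigma X sigma^-1 for it. *)
Definition freq (x : 'I_n * 'I_n) : R := d x.1 / d x.2.

(** Coordinates of the rank-one operator built on the eigenvectors k and l of A. *)
Definition amp (k l : 'I_n) (x : 'I_n * 'I_n) : C := V k x.1 * (V l x.2)^*.

(** Coefficient form between the eigenvectors k and l of A, with each modular
    frequency r weighted by f(r). *)
Definition modform (f : R -> R) k l : C :=
  \sum_x \sum_y (f (freq x))%:C * ((amp k l x)^* * T x y * amp k l y).

Lemma freq_gt0 x : 0 < freq x.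
Proof. by rewrite divr_gt0. Qed.

Lemma real_complex_eq0 (u : R) : (u%:C == 0 :> C) = (u == 0).
Proof. by rewrite eq_complex /= eqxx andbT. Qed.

(** Applying the detailed balance relation twice returns to the same coefficient
    with the factor (d_b d_i)/(d_j d_a), so it is 1 unless the coefficient is 0. *)
Lemma T_freq x y : T x y != 0 -> freq x = freq y.
Proof.
case: x y => [a i] [b j] T0; rewrite /freq /=.
have E1 := T_gns a i b j; have E2 := T_gns j b i a.
have : ((d a * d j - d b * d i)%:C * T (a, i) (b, j)) = 0.
  rewrite rmorphB !rmorphM mulrBl -mulrA E1 mulrCA E2.
  by apply/eqP; rewrite subr_eq0 -!mulrA.
move=> /eqP; rewrite mulf_eq0 (negbTE T0) orbF real_complex_eq0 subr_eq0 => /eqP dE.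
by apply/eqP; rewrite eqr_div ?lt0r_neq0 // dE.
Qed.

Lemma T_gns_freq a i b j : T (a, i) (b, j) = ((freq (j, b))^-1)%:C * T (j, b) (i, a).
Proof.
have dj : (d j)%:C != 0 :> C by rewrite real_complex_eq0 gt_eqF.
apply: (mulfI dj); rewrite T_gns mulrA -rmorphM /freq /= invf_div.
by rewrite [d j * _]mulrCA divff ?mulr1 // gt_eqF.
Qed.

Lemma modform_eq f g k l : (forall rho, 0 < rho -> f rho = g rho) ->
  modform f k l = modform g k l.
Proof.
move=> fg; apply: eq_bigr => x _; apply: eq_bigr => y _.
by rewrite fg // freq_gt0.
Qed.

Lemma modformD f g k l :
  modform (fun rho => f rho + g rho) k l = modform f k l + modform g k l.
Proof.
rewrite -big_split; apply: eq_bigr => x _; rewrite -big_split.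
by apply: eq_bigr => y _; rewrite rmorphD mulrDl.
Qed.

Lemma modformZ a f k l :
  modform (fun rho => a * f rho) k l = a%:C * modform f k l.
Proof.
rewrite mulr_sumr; apply: eq_bigr => x _; rewrite mulr_sumr.
by apply: eq_bigr => y _; rewrite rmorphM mulrA.
Qed.

(** Since T only couples equal frequencies, the weight f can be split into square
    roots on both sides, which leaves the form of T at the vector sqrt(f) amp.
    Its diagonal sum is sqrt (f 1) <l, k>, hence 0 when k and l differ or f 1 = 0. *)
Lemma modform_ge0 f k l : (forall rho, 0 < rho -> 0 <= f rho) ->
  (k = l -> f 1 = 0) -> 0 <= modform f k l.
Proof.
move=> f0 f1; pose c x := (Num.sqrt (f (freq x)))%:C * amp k l x.
have /T_ge0 : \sum_a c (a, a) = 0.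
  have E a : c (a, a) = (Num.sqrt (f 1))%:C * (V k a * (V l a)^*).
    by rewrite /c /freq /amp /= divff // gt_eqF.
  under eq_bigr do rewrite E.
  rewrite -mulr_sumr; have [kl|kl] := eqVneq k l; first by rewrite f1 // sqrtr0 mul0r.
  suff -> : \sum_a V k a * (V l a)^* = 0 by rewrite mulr0.
  transitivity ((V *m V^t*) k l); last by rewrite (unitarymxP uV) mxE (negbTE kl).
  by rewrite mxE; apply: eq_bigr => a _; rewrite !mxE.
congr (0 <= _); apply: eq_bigr => x _; apply: eq_bigr => y _.
have [->|/T_freq xy] := eqVneq (T x y) 0; first by rewrite !(mulr0, mul0r).
rewrite /c -xy conjC_realM.
rewrite -[in RHS](sqr_sqrtr (f0 _ (freq_gt0 x))) rmorphXn /=; ring.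
Qed.

(** Detailed balance exchanges k and l and inverts the frequency. *)
Lemma modform_swap f k l :
  modform f k l = modform (fun rho => rho^-1 * f rho^-1) l k.
Proof.
pose sw (x : 'I_n * 'I_n) := (x.2, x.1).
have swK : involutive sw by case.
have sw_bij : {on predT, bijective sw} by apply: onW_bij; exists sw.
rewrite /modform exchange_big (reindex _ sw_bij); apply: eq_bigr => x _.
rewrite (reindex _ sw_bij); apply: eq_bigr => y _.
case: x y => [j b] [i a]; rewrite /sw /=.
have [T0|T0] := eqVneq (T (a, i) (b, j)) 0.
  have : T (j, b) (i, a) = 0.
    move: T0; rewrite T_gns_freq => /eqP; rewrite mulf_eq0 real_complex_eq0.
    by rewrite invr_eq0 gt_eqF ?freq_gt0 // => /eqP.
  by rewrite T0 => ->; rewrite !(mulr0, mul0r).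
have freqV : freq (a, i) = (freq (j, b))^-1.
  by rewrite (T_freq T0) /freq /= invf_div.
rewrite freqV T_gns_freq rmorphM /amp /= !rmorphM /= !conjCK; ring.
Qed.

(** Summing over k inserts the identity, and unitality applies. *)
Lemma sum_modform_cst (u : R) l : \sum_k modform (fun=> u) k l = 0.
Proof.
transitivity (\sum_i \sum_j u%:C * (V l i * (V l j)^*) * \sum_a T (a, i) (a, j));
    last by rewrite big1 // => i _; rewrite big1 // => j _; rewrite T_unital mulr0.
pose G (x y : 'I_n * 'I_n) := u%:C * (V l x.2 * (V l y.2)^*) * T x y.
have colV a b : \sum_k (V k a)^* * V k b = (a == b)%:R.
  transitivity ((V^t* *m V) a b); last by rewrite (unitarymxC uV) mxE.
  by rewrite mxE; apply: eq_bigr => k _; rewrite !mxE.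
transitivity (\sum_x \sum_y G x y * (x.1 == y.1)%:R).
  rewrite exchange_big; apply: eq_bigr => x _.
  rewrite exchange_big; apply: eq_bigr => y _.
  rewrite -colV mulr_sumr; apply: eq_bigr => k _.
  rewrite /amp rmorphM /= conjCK /G; ring.
transitivity (\sum_a \sum_i \sum_j G (a, i) (a, j)).
  rewrite [RHS]pair_bigA; apply: eq_bigr => -[a i] _ /=.
  transitivity (\sum_b \sum_j G (a, i) (b, j) * (a == b)%:R).
    by rewrite pair_bigA; apply: eq_bigr => -[b j] _.
  rewrite (bigD1 a) //= [X in _ + X]big1 ?addr0 => [|b /negbTE ab].
    by apply: eq_bigr => j _; rewrite eqxx mulr1.
  by rewrite big1 // => j _; rewrite eq_sym ab mulr0.
rewrite exchange_big; apply: eq_bigr => i _.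
by rewrite exchange_big; apply: eq_bigr => j _; rewrite mulr_sumr.
Qed.

Variable al : 'I_n -> R.
Hypothesis al0 : forall k, 0 < al k.

(** When T is the matrix [choi] of L, this is the trace of
    A^(1-t) sigma^(t/2) L(sigma^(-t/2) A^t sigma^(-t/2)) sigma^(t/2),
    with A of eigenvalues al; see [powformE] and [mxtrace_choi]. *)
Definition powform (t : R) : C :=
  \sum_k \sum_l modform (fun rho => (al k / rho) `^ t * al l `^ (1 - t)) k l.

(** Expand the product in [dform]: the two linear terms vanish by unitality (after
    a swap for the one in al k / rho), and the two mixed terms are exchanged by
    the swap. *)
Lemma powform_dform t :
  \sum_k \sum_l modform (fun rho => dform t (al k / rho) (al l)) k l
  = - (2 * ((t * (1 - t))^-1)%:C * powform t).
Proof.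
(* The second mixed term is the first one after the swap. *)
have swapE : \sum_k \sum_l modform (fun rho => (al k / rho) `^ (1 - t) * al l `^ t) k l
    = powform t.
  rewrite exchange_big; apply: eq_bigr => l _; apply: eq_bigr => k _.
  rewrite modform_swap; apply: modform_eq => rho rho0.
  have rn0 : rho != 0 by rewrite gt_eqF.
  have rV : rho^-1 = rho `^ (-1) by rewrite powR_inv1 // ltW.
  rewrite invrK !powRM ?invr_ge0 ?(ltW rho0) ?(ltW (al0 _)) // rV -powRrM mulN1r.
  have <- : rho `^ (-1) * rho `^ (1 - t) = rho `^ (- t).
    by rewrite -powRD ?rn0 ?implybT //; congr (_ `^ _); ring.
  ring.
(* After the swap the term linear in al k / rho no longer depends on rho. *)
have linE : \sum_k \sum_l modform (fun rho => al k / rho) k l = 0.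
  transitivity (\sum_k \sum_l modform (fun=> al k) l k).
    apply: eq_bigr => k _; apply: eq_bigr => l _.
    rewrite modform_swap; apply: modform_eq => rho rho0.
    by rewrite invrK mulrCA mulVf ?mulr1 // gt_eqF.
  by rewrite big1 // => k _; rewrite sum_modform_cst.
have cstE : \sum_k \sum_l modform (fun=> al l) k l = 0.
  by rewrite exchange_big big1 // => l _; rewrite sum_modform_cst.
pose c := (t * (1 - t))^-1.
transitivity (c%:C * (\sum_k \sum_l modform (fun rho => al k / rho) k l
  + \sum_k \sum_l modform (fun=> al l) k l
  + (-1)%:C * powform t
  + (-1)%:C * \sum_k \sum_l modform (fun rho => (al k / rho) `^ (1 - t) * al l `^ t) k l)).
  rewrite /powform ![(-1)%:C * _]mulr_sumr -!big_split mulr_sumr; apply: eq_bigr => k _.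
  rewrite ![(-1)%:C * _]mulr_sumr -!big_split mulr_sumr; apply: eq_bigr => l _.
  rewrite /= -!modformZ -!modformD -modformZ; apply: modform_eq => rho rho0.
  have u0 : 0 < al k / rho by rewrite divr_gt0.
  have powE z : 0 < z -> z `^ t * z `^ (1 - t) = z.
    by move=> z0; rewrite -powRD ?subrKC ?powRr1 ?ltW ?(gt_eqF z0) ?implybT.
  rewrite /dform -/c mulrC; congr (_ * _).
  rewrite mulrBl !mulrBr !powE //; ring.
rewrite swapE linE cstE add0r -/c rmorphN rmorph1; ring.
Qed.

(** The difference is a sum of forms weighted by the increments of [dform] in the
    exponent. For k = l and frequency 1 both jumps vanish, which is the condition under which
    [modform_ge0] applies on the diagonal. *)
Lemma powform_nonincreasing s t : 2^-1 <= s -> s <= t -> t < 1 ->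
  ((t * (1 - t))^-1)%:C * powform t <= ((s * (1 - s))^-1)%:C * powform s.
Proof.
move=> s2 st t1.
suff : 0 <= 2 * (((s * (1 - s))^-1)%:C * powform s - ((t * (1 - t))^-1)%:C * powform t).
  by rewrite pmulr_rge0 ?subr_ge0.
have -> : 2 * (((s * (1 - s))^-1)%:C * powform s - ((t * (1 - t))^-1)%:C * powform t)
  = \sum_k \sum_l modform (fun rho => dform t (al k / rho) (al l)) k l
    + (-1)%:C * \sum_k \sum_l modform (fun rho => dform s (al k / rho) (al l)) k l.
  rewrite !powform_dform rmorphN rmorph1; ring.
rewrite mulr_sumr -big_split; apply: sumr_ge0 => k _.
rewrite mulr_sumr -big_split; apply: sumr_ge0 => l _.
rewrite /= -modformZ -modformD; apply: modform_ge0 => [rho rho0|->].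
  by rewrite mulN1r subr_ge0 dform_nondecreasing // divr_gt0.
by rewrite divr1 /dform !subrr !(mul0r, mulr0) addr0.
Qed.

Lemma powform_le0 t : 0 < t < 1 -> ((t * (1 - t))^-1)%:C * powform t <= 0.
Proof.
move=> t01; suff : 0 <= - (2 * ((t * (1 - t))^-1)%:C * powform t).
  by rewrite -mulrA oppr_ge0 pmulr_rle0.
rewrite -powform_dform; apply: sumr_ge0 => k _; apply: sumr_ge0 => l _.
apply: modform_ge0 => [rho rho0|->]; first by rewrite dform_ge0 // divr_gt0.
by rewrite divr1 /dform subrr !mul0r.
Qed.

End ModularForm.

(** * Weighted norms *)

Section WeightedNorms.
Local Open Scope complex_scope.
Local Open Scope sesquilinear_scope.
Local Open Scope ring_scope.
Variable R : realType.
Local Notation C := R[i].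

(** After normalizing the sum of the m a to 1, this is the weighted
    arithmetic-geometric mean inequality term by term. *)
Lemma jensen_powR (I : finType) (m a b : I -> R) (th : R) : 0 < th <= 1 ->
  (forall i, 0 <= m i) -> (forall i, 0 < a i) -> (forall i, 0 < b i) ->
  \sum_i m i * b i = 1 ->
  \sum_i m i * (a i `^ th * b i `^ (1 - th)) <= (\sum_i m i * a i) `^ th.
Proof.
move=> th01 m0 a0 b0 mb1; set K := \sum_i m i * a i.
have ma0 i : 0 <= m i * a i by rewrite mulr_ge0 // ltW.
have K0 : 0 < K.
  rewrite lt_def sumr_ge0 ?andbT //; apply/negP => K0.
  suff: \sum_i m i * b i == 0 by rewrite mb1 oner_eq0.
  apply/eqP; rewrite big1 // => i _; move: K0; rewrite psumr_eq0 //.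
  move=> /allP/(_ i (mem_index_enum _)); rewrite mulf_eq0 [a i == 0]gt_eqF // orbF.
  by move=> /eqP ->; rewrite mul0r.
have Kth : 0 < K `^ th by rewrite powR_gt0.
rewrite -[leRHS]mul1r -ler_pdivrMr // mulr_suml.
apply: (@le_trans _ _ (\sum_i (th / K * (m i * a i) + (1 - th) * (m i * b i)))).
  apply: ler_sum => i _.
  have aE : a i `^ th = (a i / K) `^ th * K `^ th.
    by rewrite -powRM ?divfK ?gt_eqF // ?divr_ge0 // ltW.
  rewrite [leRHS](_ : _ = m i * (th * (a i / K) + (1 - th) * b i)); last by ring.
  rewrite -mulrA ler_wpM2l // aE mulrAC mulfK ?gt_eqF //.
  by apply: powR_young => //; rewrite divr_gt0.
by rewrite big_split -!mulr_sumr /= -/K divfK ?gt_eqF // mb1 mulr1 subrKC.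
Qed.

Lemma mxpowR_udiag n (V : 'M[C]_n) d r : V \is unitarymx ->
  mxpowR (udiag V d) r = udiag V (fun i => d i `^ r).
Proof. by move=> uV; rewrite /mxpowR mxfun_udiag. Qed.

Lemma udiag_unit n (V : 'M[C]_n) d : V \is unitarymx -> (forall i, d i != 0) ->
  udiag V d \in unitmx.
Proof.
move=> uV d0; have dV : (fun i => d i * (d i)^-1) = fun=> 1.
  by apply/funext => i; rewrite divff.
have /mulmx1_unit[dU _] : udiag V d *m udiag V (fun i => (d i)^-1) = 1%:M.
  by rewrite (mulmx_udiag _ _ uV) dV (udiag1 uV).
exact: dU.
Qed.

Lemma udiag_conj n (W U : 'M[C]_n) d :
  U *m udiag W d *m U^t* = udiag (W *m U^t*) d.
Proof. by rewrite /udiag trmxC_mul trmxCK !mulmxA. Qed.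

(** The absolute value disappears because the argument is positive. *)
Lemma Lpnorm_pow n (sigma X W : 'M[C]_n) z p : 0 < p -> W \is unitarymx ->
  (forall i, 0 <= z i) -> Gam sigma p^-1 X = udiag W z ->
  Lpnorm sigma p X `^ p = \sum_i z i `^ p.
Proof.
move=> p0 uW z0 XE; rewrite /Lpnorm XE (absmx_udiag uW z0) (mxpowR_udiag _ _ uW).
rewrite (mxtrace_udiag _ uW) /=.
rewrite -powRrM mulVf ?gt_eqF // powRr1 // sumr_ge0 // => i _; exact: powR_ge0.
Qed.

Lemma Lpnorm1 n (sigma X : 'M[C]_n) : pdmx (Gam sigma 1 X) ->
  (Lpnorm sigma 1 X)%:C = \tr (Gam sigma 1 X).
Proof.
move=> /pdmxP [W [z [uW z0] XE]].
have zE : z = (fun i => z i `^ 1) by apply/funext => i; rewrite powRr1 // ltW.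
have z0' i : 0 <= z i by exact: ltW.
rewrite /Lpnorm invr1 XE (absmx_udiag uW z0') (mxpowR_udiag _ _ uW) -zE.
rewrite (mxtrace_udiag _ uW) /= powRr1 // sumr_ge0 // => i _; exact: ltW.
Qed.

Section Gamma.
Variables (n : nat) (U : 'M[C]_n) (s : 'I_n -> R).
Hypotheses (uU : U \is unitarymx) (s0 : forall i, 0 < s i).
Local Notation sigma := (udiag U s).

Lemma mxpowR_add a b : mxpowR sigma a *m mxpowR sigma b = mxpowR sigma (a + b).
Proof.
rewrite !(mxpowR_udiag _ _ uU) (mulmx_udiag _ _ uU); congr udiag.
by apply/funext => i; rewrite -powRD // lt0r_neq0 ?implybT.
Qed.

Lemma mxpowR0 : mxpowR sigma 0 = 1%:M.
Proof.
rewrite (mxpowR_udiag _ _ uU) -(udiag1 uU); congr udiag; apply/funext => i.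
by rewrite powRr0.
Qed.

Lemma Gam_comp a b X : Gam sigma a (Gam sigma b X) = Gam sigma (a + b) X.
Proof.
rewrite /Gam; move: (mxpowR_add (a / 2) (b / 2)) (mxpowR_add (b / 2) (a / 2)).
rewrite [b / 2 + _]addrC -mulrDl.
move: (mxpowR _ (a / 2)) (mxpowR _ (b / 2)) (mxpowR _ ((a + b) / 2)) => A B D AB BA.
by rewrite -{1}AB -BA !mulmxA.
Qed.

Lemma Gam0 X : Gam sigma 0 X = X.
Proof. by rewrite /Gam mul0r mxpowR0 mul1mx mulmx1. Qed.

Lemma pdmx_Gam a X : pdmx X -> pdmx (Gam sigma a X).
Proof.
rewrite /Gam (mxpowR_udiag _ _ uU); apply: pdmx_congr.
  by apply/hermsymmxP; rewrite udiag_herm.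
by apply: (udiag_unit uU) => i; rewrite gt_eqF // powR_gt0.
Qed.

(** Squared modulus of the scalar product of the i-th eigenvector of sigma and
    the j-th eigenvector of the other operator. *)
Definition overlap (W : 'M[C]_n) (i j : 'I_n) : R :=
  complex.Re ((W *m U^t*) j i) ^+ 2 + complex.Im ((W *m U^t*) j i) ^+ 2.

Lemma overlapE W i j : (overlap W i j)%:C = `|(W *m U^t*) j i| ^+ 2.
Proof. exact: add_Re2_Im2. Qed.

Lemma overlap_ge0 W i j : 0 <= overlap W i j.
Proof. by rewrite addr_ge0 ?sqr_ge0. Qed.

Lemma unitarymx_overlap (W : 'M[C]_n) : W \is unitarymx -> W *m U^t* \is unitarymx.
Proof.
have : U^t* \is unitarymx by rewrite trmxC_unitary.
by move=> uUt uW; exact: mul_unitarymx uW uUt.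
Qed.

Lemma sum_overlap W i : W \is unitarymx -> \sum_j overlap W i j = 1.
Proof.
move=> uW; apply: (@complexI R); rewrite rmorph_sum rmorph1.
have uN := unitarymx_overlap uW.
transitivity (((W *m U^t*)^t* *m (W *m U^t*)) i i).
  rewrite mxE; apply: eq_bigr => j _; rewrite [LHS]overlapE normCK mulrC.
  by rewrite !mxE.
by rewrite (unitarymxC uN) mxE eqxx.
Qed.

Lemma mxtrace_udiag2 W u z :
  \tr (udiag U u *m udiag W z) = (\sum_i \sum_j overlap W i j * (u i * z j))%:C.
Proof.
rewrite {1}/udiag -!mulmxA mxtrace_mulC -mulmxA udiag_conj /mxtrace rmorph_sum.
apply: eq_bigr => i _; rewrite mul_diag_mx [LHS]mxE udiagE mxE mulr_sumr rmorph_sum.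
apply: eq_bigr => j _; rewrite !rmorphM /= overlapE normCK; ring.
Qed.

End Gamma.
End WeightedNorms.

(** * The Dirichlet form as a power form *)

Section Dirichlet.
Local Open Scope complex_scope.
Local Open Scope sesquilinear_scope.
Local Open Scope ring_scope.
Variable R : realType.
Local Notation C := R[i].

(** The sums over k and l of [powform] reassemble the matrix coefficients of A^t
    and A^(1-t). *)
Lemma powformE n (s : 'I_n -> R) (V : 'M[C]_n) T (al : 'I_n -> R) t :
  (forall i, 0 < s i) -> (forall k, 0 < al k) ->
  powform s V T al t = \sum_x \sum_y (freq s x `^ (- t))%:C *
    (udiag V (fun k => al k `^ t) x.1 y.1 *
     udiag V (fun k => al k `^ (1 - t)) y.2 x.2) * T x y.
Proof.
move=> s0 al0; rewrite /powform /modform.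
under eq_bigr do rewrite exchange_big.
rewrite exchange_big; apply: eq_bigr => x _.
under eq_bigr do rewrite exchange_big.
rewrite exchange_big; apply: eq_bigr => y _.
rewrite !udiagE big_distrlr /= mulr_sumr mulr_suml; apply: eq_bigr => k _.
rewrite mulr_sumr mulr_suml; apply: eq_bigr => l _.
have r0 := freq_gt0 s0 x.
have -> : (al k / freq s x) `^ t = al k `^ t * freq s x `^ (- t).
  rewrite powRM ?invr_ge0 ?(ltW r0) ?(ltW (al0 k)) //; congr (_ * _).
  by rewrite -(powR_inv1 (ltW r0)) -powRrM mulN1r.
rewrite /amp !rmorphM /= conjCK; ring.
Qed.

Section Form.
Variables (n : nat) (U : 'M[C]_n) (s : 'I_n -> R).
Hypotheses (uU : U \is unitarymx) (s0 : forall i, 0 < s i).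
Local Notation sigma := (udiag U s).
Variable L : 'M[C]_n -> 'M[C]_n.
Hypothesis linL : forall a X Y, L (a *: X + Y) = a *: L X + L Y.

Lemma bvecC a : (bvec U a)^t* = delta_mx 0 a *m U.
Proof.
rewrite /bvec colE trmxC_mul trmxCK; congr (_ *m _).
by apply/matrixP => i j; rewrite !mxE andbC rmorph_nat.
Qed.

Lemma bvec_expand (M : 'M[C]_n) :
  M = \sum_a \sum_b (U *m M *m U^t*) a b *: (bvec U a *m (bvec U b)^t*).
Proof.
rewrite -{1}[M]mul1mx -{1}[M]mulmx1 -(bvec_complete uU) mulmx_suml.
apply: eq_bigr => a _; rewrite !mulmx_sumr; apply: eq_bigr => b _.
have entE : (bvec U a)^t* *m M *m bvec U b = ((U *m M *m U^t*) a b)%:M.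
  rewrite [LHS]mx11_scalar bvecC /bvec colE -!mulmxA (mulmxA M) (mulmxA U).
  rewrite -rowE -colE; congr (_%:M); rewrite -mulmxA; move: (M *m U^t*) => X.
  by rewrite !mxE; apply: eq_bigr => j _; rewrite !mxE.
transitivity (bvec U a *m ((bvec U a)^t* *m M *m bvec U b) *m (bvec U b)^t*).
  by rewrite !mulmxA.
by rewrite entE mul_mx_scalar scalemxAl.
Qed.

(** Expand both operators over the rank-one operators |f_a><f_b|. *)
Lemma mxtrace_choi (N M : 'M[C]_n) : \tr (N *m L M) =
  \sum_x \sum_y (U *m M *m U^t*) x.1 y.1 * (U *m N *m U^t*) y.2 x.2 * choi U L x y.
Proof.
have LD X Y : L (X + Y) = L X + L Y by have := linL 1 X Y; rewrite !scale1r.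
have L0 : L 0 = 0 by apply: (addIr (L 0)); rewrite -LD !add0r.
have LZ a X : L (a *: X) = a *: L X by rewrite -[a *: X]addr0 linL L0 addr0.
rewrite {1}(bvec_expand N) {1}(bvec_expand M).
pose m := U *m M *m U^t*; pose e := U *m N *m U^t*.
transitivity (\sum_a \sum_i \sum_b \sum_j
   m a b * e j i * choi U L (a, i) (b, j)); last first.
  rewrite pair_bigA; apply: eq_bigr => -[a i] _ /=.
  by rewrite pair_bigA; apply: eq_bigr => -[b j] _.
rewrite (big_morph L LD L0) mulmx_sumr raddf_sum; apply: eq_bigr => a _ /=.
rewrite (big_morph L LD L0) mulmx_sumr raddf_sum [RHS]exchange_big; apply: eq_bigr => b _ /=.
rewrite LZ -scalemxAr mxtraceZ mulmx_suml raddf_sum mulr_sumr [RHS]exchange_big.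
apply: eq_bigr => j _ /=; rewrite mulmx_suml raddf_sum mulr_sumr.
by apply: eq_bigr => i _ /=; rewrite -scalemxAl mxtraceZ mulrA.
Qed.

Lemma Gam_entry r W y a b :
  (U *m Gam sigma r (udiag W y) *m U^t*) a b =
  (s a `^ (r / 2) * s b `^ (r / 2))%:C * udiag (W *m U^t*) y a b.
Proof.
rewrite /Gam (mxpowR_udiag _ _ uU) -udiag_conj.
move: (udiag W y) => Z; rewrite /udiag -!mulmxA (mulmxA U) (unitarymxP uU) mul1mx.
rewrite mulmx1.
rewrite (mulmxA Z) (mulmxA U); move: (U *m (Z *m U^t*)) (U *m Z *m U^t*) (mulmxA U Z (U^t*)).
move=> X Y ->; rewrite mul_diag_mx mul_mx_diag !mxE rmorphM /=; ring.
Qed.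

(** The weight sigma^(1/2) of the scalar product absorbs Gam^(-1/p^) into Gam^(1/p),
    since 1 - 1/p^ = 1/p; and Z = A^t, Z^(p-1) = A^(1-t) for A = Z^p, t = 1/p.
    Equality of the frequencies of x and y merges the four powers of sigma. *)
Lemma dirichlet_powform p W z :
  (forall x y, choi U L x y != 0 -> freq s x = freq s y) ->
  1 < p -> W \is unitarymx -> (forall k, 0 < z k) ->
  dirichlet sigma L p (Gam sigma (- p^-1) (udiag W z)) =
  - (4^-1%:C * (((p^-1 * (1 - p^-1))^-1)%:C *
     powform s (W *m U^t*) (choi U L) (fun k => z k `^ p) p^-1)).
Proof.
move=> freqT p1 uW z0.
have p0 : 0 < p by lra.
have pn0 : p != 0 by rewrite gt_eqF.
rewrite /dirichlet (Gam_comp uU s0) subrr (Gam0 s uU) (mxpowR_udiag _ _ uW).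
set Z1 := udiag W (fun k => z k `^ (p - 1)).
have hZ1 : Z1^t* = Z1 by rewrite udiag_herm.
have -> G M : kms_dot sigma G M = \tr (Gam sigma 1 (G^t*) *m M).
  by rewrite /kms_dot /Gam div1r.
have -> r : (Gam sigma r Z1)^t* = Gam sigma r Z1.
  rewrite /Gam (mxpowR_udiag _ _ uU).
  move: Z1 (udiag U _) hZ1 (udiag_herm U (fun i => s i `^ (r / 2))).
  by move=> A S hA hS; rewrite !trmxC_mul hA hS mulmxA.
rewrite (Gam_comp uU s0) mxtrace_choi.
have pm1 : p - 1 != 0 by rewrite subr_eq0 gt_eqF.
have -> : 1 - (hconj p)^-1 = p^-1 by rewrite /hconj; field; rewrite pn0 pm1.
have al0 k : 0 < z k `^ p by rewrite powR_gt0.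
rewrite (powformE _ _ _ s0 al0).
have zE : z = (fun k => (z k `^ p) `^ p^-1).
  by apply/funext => k; rewrite -powRrM mulfV // powRr1 // ltW.
have z1E : (fun k => z k `^ (p - 1)) = (fun k => (z k `^ p) `^ (1 - p^-1)).
  by apply/funext => k; rewrite -powRrM mulrBr mulr1 mulfV.
rewrite mulNr mulrA; congr (- (_ * _)).
  rewrite -rmorphM; congr (_%:C); rewrite /hconj; field.
  by rewrite pn0 pm1.
apply: eq_bigr => x _; apply: eq_bigr => y _.
have [->|T0] := eqVneq (choi U L x y) 0; first by rewrite !mulr0.
have xyf : freq s x = freq s y := freqT _ _ T0.
have zE2 := congr1 (udiag (W *m U^t*)) zE.
have z1E2 := congr1 (udiag (W *m U^t*)) z1E.
rewrite [X in X * _ * _ = _](Gam_entry (- p^-1) W z x.1 y.1).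
rewrite [X in _ * X * _ = _](Gam_entry p^-1 W (fun k => z k `^ (p - 1)) y.2 x.2).
move: zE2 z1E2; move: (udiag _ z) (udiag _ (fun k => z k `^ (p - 1))).
move: (udiag _ (fun k => (z k `^ p) `^ p^-1)) (udiag _ (fun k => (z k `^ p) `^ (1 - p^-1))).
move=> A B A' B' -> ->.
have -> : freq s x `^ (- p^-1) = (freq s x `^ (- p^-1 / 2)) * (freq s y `^ (- p^-1 / 2)).
  rewrite -xyf -powRD; first by congr (_ `^ _); field.
  by rewrite (gt_eqF (freq_gt0 s0 x)) implybT.
have freqE w : freq s w `^ (- p^-1 / 2) = s w.1 `^ (- p^-1 / 2) * s w.2 `^ (p^-1 / 2).
  rewrite /freq powRM ?invr_ge0 ?(ltW (s0 _)) //; congr (_ * _).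
  by rewrite -(powR_inv1 (ltW (s0 _))) -powRrM !mulNr mul1r opprK.
rewrite !freqE !rmorphM /=; ring.
Qed.

End Form.
End Dirichlet.

(** * Comparison of the exponents *)

Section Transfer.
Local Open Scope complex_scope.
Local Open Scope sesquilinear_scope.
Local Open Scope ring_scope.
Variable R : realType.
Local Notation C := R[i].
Variables (n : nat) (U : 'M[C]_n) (s : 'I_n -> R).
Hypotheses (uU : U \is unitarymx) (s0 : forall i, 0 < s i) (s1 : \sum_i s i = 1).
Local Notation sigma := (udiag U s).

Lemma Lpnorm1_Gam p W z : W \is unitarymx -> (forall k, 0 < z k) ->
  Lpnorm sigma 1 (Gam sigma (- p^-1) (udiag W z)) =
  \sum_i \sum_j overlap U W i j * (s i `^ (1 - p^-1) * z j).
Proof.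
move=> uW z0; apply: (@complexI R).
have pdZ : pdmx (udiag W z) by apply/(udiag_pdmx _ uW).
rewrite Lpnorm1 (Gam_comp uU s0); last exact: pdmx_Gam.
have trE (S Z : 'M[C]_n) : \tr (S *m Z *m S) = \tr (S *m S *m Z).
  by rewrite mxtrace_mulC mulmxA.
rewrite /Gam trE (mxpowR_add uU s0) -splitr (mxpowR_udiag _ _ uU).
exact: mxtrace_udiag2.
Qed.

(** Jensen with exponent p/q, for a = s^(1 - 1/p) z and b = s: the exponent of s in
    a^(p/q) b^(1 - p/q) is 1 - 1/q, which is the one in the norm of Y. *)
Lemma Lpnorm1_power p q W z : 1 < p -> p <= q ->
  W \is unitarymx -> (forall k, 0 < z k) ->
  Lpnorm sigma 1 (Gam sigma (- q^-1) (udiag W (fun k => z k `^ (p / q)))) `^ q <=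
  Lpnorm sigma 1 (Gam sigma (- p^-1) (udiag W z)) `^ p.
Proof.
move=> p1 pq uW z0.
have p0 : 0 < p by lra.
have q0 : 0 < q by lra.
have th01 : 0 < p / q <= 1 by rewrite divr_gt0 // ler_pdivrMr // mul1r.
have zq0 k : 0 < z k `^ (p / q) by rewrite powR_gt0.
rewrite [X in X `^ q <= _](Lpnorm1_Gam q uW zq0).
rewrite [X in _ <= X `^ p](Lpnorm1_Gam p uW z0) !pair_bigA /=.
set K := \sum_(x : 'I_n * 'I_n) overlap U W x.1 x.2 * (s x.1 `^ (1 - p^-1) * z x.2).
have K0 : 0 <= K.
  by rewrite sumr_ge0 // => x _; rewrite !mulr_ge0 ?overlap_ge0 ?powR_ge0 ?ltW.
have -> : K `^ p = (K `^ (p / q)) `^ q by rewrite -powRrM divfK // gt_eqF.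
apply: ge0_ler_powR; rewrite ?nnegrE ?(ltW q0) ?powR_ge0 //.
  by rewrite sumr_ge0 // => x _; rewrite !mulr_ge0 ?overlap_ge0 ?powR_ge0.
have := @jensen_powR R ('I_n * 'I_n)%type (fun x => overlap U W x.1 x.2)
  (fun x => s x.1 `^ (1 - p^-1) * z x.2) (fun x => s x.1) (p / q) th01
  (fun x => overlap_ge0 U W x.1 x.2).
rewrite -/K => jensen; apply: le_trans (jensen _ _ _) => //.
- apply: ler_sum => x _; rewrite ler_wpM2l ?overlap_ge0 //.
  rewrite powRM ?powR_ge0 ?(ltW (z0 _)) // -powRrM mulrAC -powRD.
    by rewrite le_eqVlt; apply/orP; left; apply/eqP; congr (_ `^ _ * _); field; rewrite !gt_eqF.
  by rewrite (gt_eqF (s0 _)) implybT.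
- by move=> x; rewrite mulr_gt0 ?powR_gt0.
rewrite -(pair_bigA _ (fun i j => overlap U W i j * s i)) /= -s1.
by apply: eq_bigr => i _; rewrite -mulr_suml sum_overlap // mul1r.
Qed.

Variable L : 'M[C]_n -> 'M[C]_n.
Hypothesis linL : forall a X Y, L (a *: X + Y) = a *: L X + L Y.
Hypothesis T_ge0 : forall c : 'I_n * 'I_n -> C, \sum_a c (a, a) = 0 ->
  0 <= \sum_x \sum_y (c x)^* * choi U L x y * c y.
Hypothesis T_gns : forall a i b j,
  (s j)%:C * choi U L (a, i) (b, j) = (s b)%:C * choi U L (j, b) (i, a).
Hypothesis T_unital : forall i j, \sum_a choi U L (a, i) (a, j) = 0.

Let freqT := T_freq s0 T_gns.

Lemma pdmx_Gam_repr p X : 1 < p -> pdmx X ->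
  exists W : 'M[C]_n, exists2 z : 'I_n -> R, W \is unitarymx /\ (forall k, 0 < z k)
    & X = Gam sigma (- p^-1) (udiag W z).
Proof.
move=> p1 pX; have [W [z Wz ZE]] := pdmxP (pdmx_Gam uU s0 p^-1 pX).
by exists W, z => //; rewrite -ZE (Gam_comp uU s0) addrC subrr (Gam0 s uU).
Qed.

Lemma invp_itv (p : R) : 1 < p -> 0 < p^-1 < 1.
Proof. by move=> p1; rewrite invr_gt0 invf_lt1 ?p1 ?andbT; lra. Qed.

Lemma dirichlet_ge0 p X : 1 < p -> pdmx X -> 0 <= dirichlet sigma L p X.
Proof.
move=> p1 /(pdmx_Gam_repr p1)[W [z [uW z0] ->]].
rewrite (dirichlet_powform uU s0 linL freqT p1 uW z0) oppr_ge0.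
rewrite pmulr_rle0 ?ltcR ?invr_gt0 //.
have zp0 k : 0 < z k `^ p by rewrite powR_gt0.
exact: (powform_le0 s0 (unitarymx_overlap uU uW) T_ge0 T_gns T_unital zp0 (invp_itv p1)).
Qed.

(** Both sides have the same operator A = Z^p, so only the exponent t varies. *)
Lemma stroock_varopoulos p q W z : 1 < p -> p <= q -> q <= 2 ->
  W \is unitarymx -> (forall k, 0 < z k) ->
  dirichlet sigma L q (Gam sigma (- q^-1) (udiag W (fun k => z k `^ (p / q)))) <=
  dirichlet sigma L p (Gam sigma (- p^-1) (udiag W z)).
Proof.
move=> p1 pq q2 uW z0.
have q1 : 1 < q by exact: lt_le_trans pq.
have zq0 k : 0 < z k `^ (p / q) by rewrite powR_gt0.
rewrite [X in X <= _](dirichlet_powform uU s0 linL freqT q1 uW zq0).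
rewrite [X in _ <= X](dirichlet_powform uU s0 linL freqT p1 uW z0).
have -> : (fun k => (z k `^ (p / q)) `^ q) = (fun k => z k `^ p).
  by apply/funext => k; rewrite -powRrM divfK // gt_eqF //; lra.
have zp0 k : 0 < z k `^ p by rewrite powR_gt0.
rewrite lerN2; apply: ler_wpM2l; first by rewrite ler0c invr_ge0.
apply: (powform_nonincreasing s0 (unitarymx_overlap uU uW) T_ge0 T_gns T_unital zp0).
- by rewrite lef_pV2 ?posrE //; lra.
- by rewrite lef_pV2 ?posrE //; lra.
- by have /andP[] := invp_itv p1.
Qed.

Lemma hconj_gt0 (p : R) : 1 < p -> 0 < hconj p.
Proof. by move=> p1; rewrite /hconj divr_gt0; lra. Qed.

Lemma beckner0 p : 1 < p -> beckner sigma L p 0.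
Proof. by move=> p1 X pX; rewrite !mul0r; exact: dirichlet_ge0. Qed.

(** The constant is the one for which a q/(q-1) is preserved. *)
Lemma beckner_transfer p q a : 1 < p -> p <= q -> q <= 2 -> 0 <= a ->
  beckner sigma L q a -> beckner sigma L p (a * hconj q / hconj p).
Proof.
move=> p1 pq q2 a0 bec X pX.
have q1 : 1 < q by exact: lt_le_trans pq.
have [W [z [uW z0] XE]] := pdmx_Gam_repr p1 pX.
(* Same operator Z^p at both exponents. *)
pose Y := Gam sigma (- q^-1) (udiag W (fun k => z k `^ (p / q))).
have zq0 k : 0 < z k `^ (p / q) by rewrite powR_gt0.
have pY : pdmx Y.
  exact: (pdmx_Gam uU s0 (- q^-1) ((udiag_pdmx (fun k => z k `^ (p / q)) uW).2 zq0)).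
have p0 : 0 < p by lra.
have q0 : 0 < q by lra.
have GX : Gam sigma p^-1 X = udiag W z.
  by rewrite XE (Gam_comp uU s0) subrr (Gam0 s uU).
have GY : Gam sigma q^-1 Y = udiag W (fun k => z k `^ (p / q)).
  by rewrite (Gam_comp uU s0) subrr (Gam0 s uU).
have normX := Lpnorm_pow p0 uW (fun k => ltW (z0 k)) GX.
have normY : Lpnorm sigma q Y `^ q = \sum_k z k `^ p.
  rewrite (Lpnorm_pow q0 uW (fun k => ltW (zq0 k)) GY).
  by apply: eq_bigr => k _; rewrite -powRrM divfK // gt_eqF.
have dirXY := stroock_varopoulos p1 pq q2 uW z0.
rewrite -XE -/Y in dirXY.
apply: (le_trans _ dirXY); apply: (le_trans _ (bec Y pY)); rewrite lecR.
have norm1 := Lpnorm1_power p1 pq uW z0.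
rewrite -XE -/Y in norm1.
have cst0 : 0 <= a * hconj q by rewrite mulr_ge0 // ltW // hconj_gt0.
rewrite (divfK (lt0r_neq0 (hconj_gt0 p1))).
rewrite [X in _ * (X - _) <= _]normX [X in _ <= _ * (X - _)]normY.
exact: (ler_wpM2l cst0 (lerB (lexx _) norm1)).
Qed.

End Transfer.

(** * Beckner constants of a primitive semigroup *)

Section Comparison.
Local Open Scope complex_scope.
Local Open Scope sesquilinear_scope.
Local Open Scope ring_scope.
Variables (R : realType) (n : nat) (P : R -> {linear 'M[R[i]]_n -> 'M[R[i]]_n}).
Variables (L : 'M[R[i]]_n -> 'M[R[i]]_n) (sigma : 'M[R[i]]_n).
Hypotheses (hP : qms P) (hL : generator P L) (hprim : primitive P sigma).
Hypothesis hgns : gns_detailed_balance sigma L.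

(** Positivity together with full rank makes all eigenvalues of sigma positive. *)
Lemma primitive_udiag : exists U : 'M[R[i]]_n, exists2 s : 'I_n -> R,
  [/\ U \is unitarymx, forall i, 0 < s i & \sum_i s i = 1] & sigma = udiag U s.
Proof.
have [[[psd tr1] _] _ rk] := hprim.
have [U [s [uU s0] sE]] := psdmx_full_rank psd rk.
exists U, s => //; split=> //; apply: (@complexI R).
by rewrite -(mxtrace_udiag s uU) -sE tr1.
Qed.

Lemma qms_beckner p q a : 1 < p -> p <= q -> q <= 2 -> 0 <= a ->
  beckner sigma L q a -> beckner sigma L p (a * hconj q / hconj p).
Proof.
have [U [s [uU s0 s1] sE]] := primitive_udiag; move: hgns; rewrite sE => gns.
exact: (beckner_transfer uU s0 s1 (generator_linear hL)
  (choi_generator_ge0 uU hP hL) (fun a i b j => choi_generator_gns uU hP hL a i b j gns)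
  (choi_generator_unital uU hP hL)).
Qed.

Lemma qms_beckner0 p : 1 < p -> beckner sigma L p 0.
Proof.
have [U [s [uU s0 s1] sE]] := primitive_udiag; move: hgns; rewrite sE => gns.
exact: (beckner0 uU s0 (generator_linear hL)
  (choi_generator_ge0 uU hP hL) (fun a i b j => choi_generator_gns uU hP hL a i b j gns)
  (choi_generator_unital uU hP hL)).
Qed.

(** Each constant a at q gives max (a, 0) q^/p^ at p. *)
Lemma beckner_opt_nonincreasing p q : 1 < p -> p <= q -> q <= 2 ->
  ((hconj q)%:E * beckner_opt sigma L q <= (hconj p)%:E * beckner_opt sigma L p)%E.
Proof.
move=> p1 pq q2; have q1 : 1 < q by exact: lt_le_trans pq.
have hp0 := hconj_gt0 p1; have hq0 := hconj_gt0 q1.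
rewrite -lee_pdivlMl //; apply: ge_ereal_sup => _ [a /= Ba <-].
rewrite lee_pdivlMl //.
pose b := Num.max a 0 * hconj q / hconj p.
have Bb : beckner sigma L p b.
  rewrite /b; have [a0|a0] := leP 0 a; first exact: qms_beckner q2 a0 Ba.
  have -> : 0 * hconj q / hconj p = 0 by rewrite !mul0r.
  exact: qms_beckner0.
apply: (@le_trans _ _ ((hconj p)%:E * b%:E)%E).
  rewrite -!EFinM lee_fin /b mulrC [leRHS]mulrC divfK ?gt_eqF //.
  by rewrite ler_pM2r // le_max lexx.
by rewrite lee_pmul2l // ?lte_fin //; apply: ereal_sup_ubound; exists b.
Qed.

End Comparison.

Local Open Scope ring_scope.
Local Open Scope complex_scope.

Theorem proposition3p13 (R : realType) (n : nat)
    (P : R -> {linear 'M[R[i]]_n -> 'M[R[i]]_n})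
    (L : 'M[R[i]]_n -> 'M[R[i]]_n) (sigma : 'M[R[i]]_n)
    (hP : qms P) (hL : generator P L)
    (hprim : primitive P sigma)
    (hgns : gns_detailed_balance sigma L) :
  (forall p' alpha' : R, 1 < p' -> p' <= 2 -> 0 < alpha' ->
     beckner sigma L p' alpha' ->
     forall p : R, 1 < p -> p <= p' ->
       exists2 alpha : R, beckner sigma L p alpha
         & p' / (p' - 1) * alpha' <= p / (p - 1) * alpha)
  /\
  (forall p p' : R, 1 < p -> p <= p' -> p' <= 2 ->
     ((p' / (p' - 1))%:E * beckner_opt sigma L p'
        <= (p / (p - 1))%:E * beckner_opt sigma L p)%E).
Proof.
split=> [q a q1 q2 a0 Ba p p1 pq | p q p1 pq q2]; last first.
  exact: (beckner_opt_nonincreasing hP hL hprim hgns p1 pq q2).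
exists (a * hconj q / hconj p).
  exact: (qms_beckner hP hL hprim hgns p1 pq q2 (ltW a0) Ba).
rewrite -/(hconj p) -/(hconj q) [leRHS]mulrC divfK; first by rewrite mulrC.
exact: lt0r_neq0 (hconj_gt0 p1).
Qed.
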